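(* Let $\mathcal{X}$ be a finite-dimensional real vector space, $\mathcal{C}\subset\mathcal{X}$ a closed pointed convex cone with nonempty interior $\mathcal{C}^0$. Let $\phi:\mathcal{C}^0\to\mathcal{X}$ be continuously differentiable with $\phi(\lambda x)=\lambda\phi(x)$ for all $\lambda>0$, $x\in\mathcal{C}^0$. Let $U\subset\mathcal{C}^0$ be a convex open set such that $\lambda U=U$ for all $\lambda>0$. Then the optimal contraction rate $\alpha(U)$ in Hilbert's projective metric of the flow of $\dot x=\phi(x)$ on $U$ satisfies $$\alpha(U)=\sup_{x\in U}c(x),$$ where $$c(x)=-\inf_{z\in[0,x]}\ \inf_{\substack{\nu,\pi\in\mathcal{P}(x)\\ \langle\pi,z\rangle+\langle\nu,x-z\rangle=0}}\big(\langle\pi,D\phi(x)z\rangle+\langle\nu,D\phi(x)(x-z)\rangle\big).$$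
   Context: Pointed: $\mathcal{C}\cap(-\mathcal{C})=\{0\}$. Order: $x\le y$ iff $y-x\in\mathcal{C}$; $[0,x]=\{z:0\le z\le x\}$. For $x,y\in\mathcal{C}^0$, Hilbert's projective metric is $d_H(x,y)=\log\big(\inf\{t\in\mathbb{R}:x\le ty\}/\sup\{t\in\mathbb{R}:x\ge ty\}\big)$. Dual cone $\mathcal{C}^\star=\{\mu\in\mathcal{X}^\star:\langle\mu,x\rangle\ge0\ \forall x\in\mathcal{C}\}$; for $x\in\mathcal{C}^0$, $\mathcal{P}(x)=\{\mu\in\mathcal{C}^\star:\langle\mu,x\rangle=1\}$. For $x_0\in\mathcal{C}^0$, $t\mapsto M_t(x_0)$ is the unique maximal solution in $\mathcal{C}^0$ of $\dot x=\phi(x)$, $x(0)=x_0$, on its maximal interval $J(x_0)$. For $x_0\in U$, $t_U(x_0)=\sup\{t_0\in J(x_0):t_0\ge0,\ M_t(x_0)\in U\ \forall t\in[0,t_0)\}$. The optimal contraction rate is $$\alpha(U)=\inf\{\alpha\in\mathbb{R}:\ d_H(M_t(x_1),M_t(x_2))\le e^{\alpha t}d_H(x_1,x_2)\ \text{for all }x_1,x_2\in U,\ 0\le t<\min(t_U(x_1),t_U(x_2))\}.$$ Infima and suprema are taken in $[-\infty,+\infty]$, with $\inf\emptyset=+\infty$, $\sup\emptyset=-\infty$. *)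

(* Defs.v *)
From HB Require Import structures.
From mathcomp Require Import all_boot all_order all_algebra.
From mathcomp Require Import all_classical all_reals all_analysis.

Set Implicit Arguments.
Unset Strict Implicit.
Unset Printing Implicit Defensive.

Import Order.TTheory GRing.Theory Num.Theory.
Import numFieldNormedType.Exports.

Local Open Scope classical_set_scope.
Local Open Scope ring_scope.

Section Cones.
Context {R : realType} {X : normedModType R}.
Implicit Types (C : set X) (x y z : X).

Definition cone C := forall (l : R) x, 0 <= l -> C x -> C (l *: x).

Definition pointed_cone C := C `&` [set - x | x in C] = [set 0].

Definition cone_le C x y := C (y - x).

Definition order_segment C x := [set z | cone_le C 0 z /\ cone_le C z x].

(* Extended-real valued, so that the quotient of the infimum by the supremum
   needs no side condition.  On the interior of a closed pointed cone of
   positive dimension both are positive reals. *)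
Definition hilbert_dist C x y : \bar R :=
  lne (ereal_inf [set t%:E | t in [set t : R | cone_le C x (t *: y)]] /
       ereal_sup [set t%:E | t in [set t : R | cone_le C (t *: y) x]])%E.

(* All linear functionals are allowed: X is finite-dimensional in the intended
   use, so they are all continuous. *)
Definition dual_cone C : set {scalar X} :=
  [set mu | forall x, C x -> 0 <= mu x].

Definition normalized_dual C x : set {scalar X} :=
  [set mu | dual_cone C mu /\ mu x = 1].

End Cones.

Section Flow.
Context {R : realType} {X : normedModType R}.
Implicit Types (D U : set X) (phi : X -> X).

(* Meant for an open D, so that the values of phi outside D play no role.  The
   second clause is continuity of the derivative for the operator norm. *)
Definition continuously_differentiable_on D phi :=
  (forall x, D x -> differentiable phi x) /\
  (forall x, D x -> forall e : R, 0 < e ->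
     \forall y \near x, forall v, `|'d phi y v - 'd phi x v| <= e * `|v|).

Definition is_solution phi D (x0 : X) (J : set R) (x : R -> X) :=
  [/\ open J, is_interval J, J 0, x 0 = x0 &
      forall t, J t -> D (x t) /\ is_derive t 1 x (phi (x t))].

Definition is_maximal_solution phi D (x0 : X) (s : set R * (R -> X)) :=
  is_solution phi D x0 s.1 s.2 /\
  forall J x, is_solution phi D x0 J x -> s.1 `<=` J ->
    (forall t, s.1 t -> x t = s.2 t) -> J `<=` s.1.

(* For phi continuously differentiable on the open set D and x0 in D, a maximal
   solution exists, its interval is unique and its values on that interval are
   unique; neither the default value nor the values outside the interval
   matter. *)
Definition maximal_solution phi D (x0 : X) : set R * (R -> X) :=
  xget (set0, cst x0) [set s | is_maximal_solution phi D x0 s].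

Definition flow_domain phi D (x0 : X) : set R := (maximal_solution phi D x0).1.

Definition flow phi D (t : R) (x0 : X) : X := (maximal_solution phi D x0).2 t.

Definition exit_time phi D U (x0 : X) : \bar R :=
  ereal_sup [set t0%:E | t0 in
    [set t0 : R | [/\ flow_domain phi D x0 t0, 0 <= t0 &
                      forall t, 0 <= t < t0 -> U (flow phi D t x0)]]].

End Flow.

Section ContractionRate.
Context {R : realType} {X : normedModType R}.
Implicit Types (C U : set X) (phi : X -> X) (x : X).

Definition contraction_rate C phi U : \bar R :=
  ereal_inf [set a%:E | a in [set a : R |
    forall x1 x2, U x1 -> U x2 -> forall t : R, 0 <= t ->
      (t%:E < Order.min (exit_time phi C° U x1) (exit_time phi C° U x2))%E ->
      (hilbert_dist C (flow phi C° t x1) (flow phi C° t x2)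
         <= (expR (a * t))%:E * hilbert_dist C x1 x2)%E]].

(* np is the pair (nu, pi); both infima are +oo over an empty set. *)
Definition infinitesimal_rate C phi x : \bar R :=
  oppe (ereal_inf [set
    ereal_inf [set (np.2 ('d phi x z) + np.1 ('d phi x (x - z)))%:E |
      np in [set np : {scalar X} * {scalar X} |
        [/\ normalized_dual C x np.1, normalized_dual C x np.2 &
            np.2 z + np.1 (x - z) = 0]]]
    | z in order_segment C x]).

End ContractionRate.

(* Main.v *)
Require Import Defs.
From HB Require Import structures.
From mathcomp Require Import all_boot all_order all_algebra.
From mathcomp Require Import all_classical all_reals all_analysis.
From mathcomp Require Import ring lra.

Set Implicit Arguments.
Unset Strict Implicit.
Unset Printing Implicit Defensive.

Import Order.TTheory GRing.Theory Num.Theory.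
Import numFieldNormedType.Exports.

Local Open Scope classical_set_scope.
Local Open Scope ring_scope.

(** The Hilbert metric is written with the gauge [gauge C x y], the least [t]
    such that [x <= t y]: on the interior of the cone it is
    [ln (gauge C x y) + ln (gauge C y x)].  By Hahn-Banach each gauge is attained
    by a positive functional, so the metric is a maximum of the smooth functions
    [ln (mu x) - ln (mu y) + ln (nu y) - ln (nu x)] with [mu], [nu] in the dual
    cone.

    Upper bound.  Let [a] dominate [c] on [U], let [x1], [x2] be points of [U],
    and let [mu], [nu] be functionals attaining the two gauges.  Along the flow,
    the derivative of the above function is [F 1 - F 0] where
    [F s = mu (phi y) / mu y - nu (phi y) / nu y] and [y = y s] runs along the
    segment from [x2] to [x1], which stays in [U] by convexity.  At each [y s] the
    direction [x1 - x2], shifted by a multiple of [y s] and rescaled, is a vector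
    of [[0, y s]] at which [mu] takes the largest and [nu] the smallest
    normalized value: this is an admissible triple in the definition of
    [c (y s)], and Euler's identity for the homogeneous field [phi] identifies
    [F' s] with the quantity bounded by [c].  Hence [F' <= a G'] with
    [G s = ln (mu (y s)) - ln (nu (y s))], and integrating gives speed at most
    [a] times the distance ([hilbert_speed_le]).  The segment is used only
    infinitesimally in time, so it does not matter that its image under the flow
    may leave [U].  Since the distance is a maximum of functions, a functional
    attaining it at time [t] bounds it from below before [t]; this controls its
    left Dini derivative and yields the exponential bound
    ([hilbert_metric_contraction]).

    Lower bound.  Given an admissible triple [z], [nu], [pi] at [x], start the
    flow at [x + e z] and at [x].  Their distance is at most [ln (1 + e)], and
    the lower estimate of the distance by the functionals [nu], [pi] is exact at
    time 0.  Differentiating the contraction inequality at time 0 and then at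
    [e = 0] produces the inequality defining [c] ([rate_lower_bound]).  For this
    the flow must really exist: local solutions come from Picard iteration and
    maximal ones from Zorn's lemma. *)

(** * Derivatives of curves *)

(** The first-order expansion of a curve, in which linear functionals can be
    applied to the remainder. *)
Lemma is_derive1_littleP (R : realType) (V : normedModType R) (f : R -> V)
    (t : R) (d : V) :
  is_derive t 1 f d <->
  forall e : R, 0 < e ->
    \forall h \near (0 : R), `|f (t + h) - f t - h *: d| <= e * `|h|.
Proof.
split=> [[df <-] e e0|H].
- move: df => /cvg_ex[l fl].
  have -> : 'D_1 f t = l by apply: cvg_lim fl; exact: norm_hausdorff.
  move/cvgrPdist_le : fl => /(_ e e0).
  rewrite near_withinE => fl; near=> h.
  have [->|h0] := eqVneq h 0; first by rewrite addr0 subrr scale0r subrr !normr0 mulr0.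
  have : h != 0 -> `|l - h^-1 *: (f (h *: 1 + t) - f t)| <= e by near: h.
  move=> /(_ h0).
  rewrite [h *: _]mulr1 [h + t]addrC => le1.
  have -> : f (t + h) - f t - h *: l = - h *: (l - h^-1 *: (f (t + h) - f t)).
    by rewrite scalerBr scalerA mulNr mulfV// !scaleNr scale1r opprK addrC.
  by rewrite normrZ normrN mulrC ler_wpM2r.
- have fl : h^-1 *: ((f \o shift t) (h *: 1) - f t) @[h --> 0^'] --> d.
    apply/cvgrPdist_le => e e0; rewrite near_withinE; near=> h => h0.
    have le1 : `|f (t + h) - f t - h *: d| <= e * `|h| by near: h; exact: H.
    rewrite /= [h *: _]mulr1 [h + t]addrC.
    have -> : d - h^-1 *: (f (t + h) - f t) = - h^-1 *: (f (t + h) - f t - h *: d).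
      rewrite [RHS]scalerBr scalerA mulNr mulVf// scaleN1r opprK scaleNr addrC//.
    by rewrite normrZ normrN normfV mulrC ler_pdivrMr// normr_gt0.
  split; first by apply/cvg_ex; exists d.
  by apply: cvg_lim fl; exact: norm_hausdorff.
Unshelve. all: by end_near. Qed.

Lemma is_derive1_continuous (R : realType) (V : normedModType R) (f : R -> V)
    (t : R) (d : V) : is_derive t 1 f d -> {for t, continuous f}.
Proof. by move=> [df _]; exact/differentiable_continuous/derivable1_diffP. Qed.

Lemma is_derive1_diff_comp (R : realType) (V W : normedModType R) (g : V -> W)
    (f : R -> V) (t : R) (d : V) :
  is_derive t 1 f d -> differentiable g (f t) ->
  is_derive t 1 (g \o f) ('d g (f t) d).
Proof.
move=> [/derivable1_diffP df <-] dg.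
have dgf : differentiable (g \o f) t by exact: differentiable_comp.
split; first exact/derivable1_diffP.
by rewrite !deriveE// diff_comp.
Qed.

Lemma is_derive1_lin_comp (R : realType) (V : normedModType R) (l : {scalar V})
    (K : R) (f : R -> V) (t : R) (d : V) :
  (forall v, `|l v| <= K * `|v|) -> is_derive t 1 f d ->
  is_derive t 1 (l \o f) (l d).
Proof.
move=> lK /is_derive1_littleP fd; apply/is_derive1_littleP => e e0.
have K0 : 0 < `|K| + 1 by rewrite ltr_wpDl.
near=> h.
have le1 : `|f (t + h) - f t - h *: d| <= e / (`|K| + 1) * `|h|.
  by near: h; apply: fd; rewrite divr_gt0.
have -> : (l \o f) (t + h) - (l \o f) t - h *: l d = l (f (t + h) - f t - h *: d).
  by rewrite !linearB scalarZ.
apply: (le_trans (lK _)); apply: (@le_trans _ _ ((`|K| + 1) * (e / (`|K| + 1) * `|h|))).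
  apply: (@le_trans _ _ ((`|K| + 1) * `|f (t + h) - f t - h *: d|)).
    by rewrite ler_wpM2r// (le_trans (ler_norm _))// lerDl.
  by rewrite ler_wpM2l// ltW.
by rewrite mulrA mulrCA divff ?mulr1// gt_eqF.
Unshelve. all: by end_near. Qed.

Lemma is_derive1_line (R : realType) (V : normedModType R) (x v : V) (t : R) :
  is_derive t 1 (fun s : R => x + s *: v) v.
Proof.
apply/is_derive1_littleP => e e0; near=> h.
rewrite /= scalerDl addrA [X in X - _]addrAC subrr add0r subrr normr0.
by rewrite mulr_ge0// ltW.
Unshelve. all: by end_near. Qed.

(** Both differentiations of the lower bound, in time and in the size of the
    perturbation, are instances of this one-sided test. *)
Lemma deriv_le0_right (R : realType) (h : R -> R) (l tau : R) :
  0 < tau -> h 0 = 0 -> (forall t, 0 <= t < tau -> h t <= 0) ->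
  is_derive (0 : R) 1 h l -> l <= 0.
Proof.
move=> tau0 h0 hle /is_derive1_littleP H; apply/ler_addgt0Pl => e e0; rewrite addr0.
have [d /= d0 dP] := H e e0.
pose t := Num.min (tau / 2) (d / 2).
have t0 : 0 < t by rewrite lt_min !divr_gt0.
have tt : t < tau by rewrite gt_min; apply/orP; left; lra.
have td : t < d by rewrite gt_min; apply/orP; right; lra.
have := dP t; rewrite /ball_/= sub0r normrN gtr0_norm// => /(_ td).
rewrite add0r h0 subr0 ler_norml => /andP[+ _].
have : h t <= 0 by rewrite hle// tt ltW.
have -> : t *: l = t * l by [].
move=> ht le1.
by rewrite -(ler_pM2l t0); clearbody t; lra.
Qed.

Lemma is_derive1_div (R : realType) (f g : R -> R) (t f' g' : R) :
  is_derive t 1 f f' -> is_derive t 1 g g' -> g t != 0 ->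
  is_derive t 1 (fun s => f s / g s) (f' / g t - f t / g t * (g' / g t)).
Proof.
move=> ff gg g0.
have H := is_deriveM ff (is_deriveV g0 gg).
apply: (is_derive_eq H).
rewrite !scaleNr !scalerN.
have -> : f t *: (g t ^- 2 *: g') = f t * (g t ^- 2 * g') by [].
have -> : (g t)^-1 *: f' = (g t)^-1 * f' by [].
by field.
Qed.

Lemma is_derive1_ln (R : realType) (f : R -> R) (t f' : R) :
  is_derive t 1 f f' -> 0 < f t ->
  is_derive t 1 (fun s => ln (f s)) (f' / f t).
Proof.
move=> ff f0; apply: (is_derive_eq (is_derive1_comp (is_derive1_ln f0) ff)).
by rewrite mulrC.
Qed.

Lemma is_derive1_expR_scale (R : realType) (a t : R) :
  is_derive t 1 (fun s => expR (a * s)) (a * expR (a * t)).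
Proof.
have d1 : is_derive t 1 (fun s : R => a * s) a.
  by have := is_deriveZ a (is_derive_id t (1 : R)); rewrite [_ *: _]mulr1.
apply: (is_derive_eq (is_derive1_comp (is_derive_expR (a * t)) d1)).
by rewrite mulrC.
Qed.

(** Euler's identity: differentiate [phi ((1 + s) x) = (1 + s) phi x] at
    [s = 0]. *)
Lemma diff_homogeneous (R : realType) (V W : normedModType R) (phi : V -> W)
    (x : V) :
  (forall l : R, 0 < l -> phi (l *: x) = l *: phi x) ->
  differentiable phi x -> 'd phi x x = phi x.
Proof.
move=> hom dphi; pose g (s : R) := x + s *: x.
have dg : is_derive (0 : R) 1 (phi \o g) ('d phi x x).
  have := @is_derive1_diff_comp _ _ _ phi _ _ _ (is_derive1_line x x 0).
  by rewrite /= scale0r addr0; apply.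
have dg' : is_derive (0 : R) 1 (phi \o g) (phi x).
  apply/is_derive1_littleP => e e0; near=> h.
  have h1 : 0 < 1 + h.
    have : `|h| < 1.
      near: h; apply/nbhs_normP; exists 1 => [|z]; first exact: ltr01.
      by rewrite /ball_/= sub0r normrN.
    by rewrite ltr_norml => /andP[]; lra.
  rewrite /g/= add0r scale0r addr0 -{1}(scale1r x) -scalerDl hom//.
  by rewrite scalerDl scale1r addrAC addrK subrr normr0 mulr_ge0// ltW.
by rewrite -(@derive_val _ _ _ _ _ _ _ dg) (@derive_val _ _ _ _ _ _ _ dg').
Unshelve. all: by end_near. Qed.

Lemma deriv_le0_decr (R : realType) (f df : R -> R) :
  (forall t : R, 0 <= t <= 1 -> is_derive t 1 f (df t)) ->
  (forall t : R, 0 <= t <= 1 -> df t <= 0) -> f 1 <= f 0.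
Proof.
move=> fd dle.
have [||c c01 fE] := @MVT_segment R f df 0 1 ler01.
- by move=> t /[!in_itv]/= /andP[t0 t1]; apply: fd; rewrite !ltW.
- apply: derivable_within_continuous => t; rewrite in_itv/= => t01.
  by have [] := fd t t01.
by rewrite -subr_le0 fE subr0 mulr1; apply: dle; rewrite in_itv/= in c01.
Qed.

(** * A comparison principle for left Dini derivatives *)

(** The set of [s] from which the bound at [T] follows has a least element, by
    upper semicontinuity from the right; by the hypothesis on the left of each
    positive time, that element must be 0. *)
Lemma dini_le (R : realType) (g : R -> R) (T e : R) :
  0 <= T ->
  (forall t, 0 <= t < T -> forall c, g t < c ->
     exists2 d : R, 0 < d & forall s, t <= s < t + d -> s <= T -> g s < c) ->
  (forall t, 0 < t <= T -> exists2 s, 0 <= s < t & g t - e * (t - s) <= g s) ->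
  g T <= g 0 + e * T.
Proof.
move=> T0 usc ext.
pose S := [set s | 0 <= s <= T /\ g T <= g s + e * (T - s)].
have ST : S T by split; [rewrite T0 lexx | rewrite subrr mulr0 addr0].
have Slb : lbound S 0 by move=> s [/andP[]].
have hS : has_inf S by split; [exists T | exists 0].
pose s0 := inf S.
have s00 : 0 <= s0 by apply: lb_le_inf => //; exists T.
have s0T : s0 <= T by apply: ge_inf => //; exists 0.
have Ss0 : S s0.
  split; first by rewrite s00.
  have [->|s0T'] := eqVneq s0 T; first by rewrite subrr mulr0 addr0.
  have {}s0T' : s0 < T by rewrite lt_neqAle s0T' s0T.
  apply/ler_addgt0Pl => r r0.
  have [//||d d0 dP] := usc s0 _ (g s0 + r / 2); first by rewrite s00.
    by rewrite ltrDl divr_gt0.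
  pose d' := Num.min d (r / (2 * (`|e| + 1))).
  have e1 : 0 < `|e| + 1 by rewrite ltr_wpDl.
  have d'0 : 0 < d' by rewrite lt_min d0 divr_gt0// mulr_gt0.
  have [s [sT gs] ss0] := inf_adherent d'0 hS.
  have s0s : s0 <= s by apply: ge_inf; [exists 0 | split].
  have gss : g s < g s0 + r / 2.
    apply: dP; last by case/andP: sT.
    by rewrite s0s/= (lt_le_trans ss0)// lerD2l ge_min lexx.
  have es : - e * (s - s0) <= r / 2.
    apply: (le_trans (ler_norm _)); rewrite normrM normrN.
    rewrite [`|s - s0|]ger0_norm ?subr_ge0//.
    apply: (@le_trans _ _ ((`|e| + 1) * d')).
      apply: ler_pM; rewrite ?subr_ge0 ?lerDl//.
      by rewrite lerBlDl ltW.
    rewrite mulrC -ler_pdivlMr//.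
    have -> : r / 2 / (`|e| + 1) = r / (2 * (`|e| + 1)) by rewrite invfM mulrA.
    by rewrite ge_min lexx orbT.
  nra.
have [s0E|s0N] := eqVneq s0 0; first by case: Ss0 => _; rewrite s0E subr0.
have s0p : 0 < s0 by rewrite lt_neqAle eq_sym s0N s00.
have [|s /andP[s_0 ss0] gs] := ext s0; first by rewrite s0p.
have Ss : S s.
  split; first by rewrite s_0/= (le_trans (ltW ss0)).
  by case: Ss0 => _ ?; nra.
have : s0 <= s by apply: ge_inf => //; exists 0.
by rewrite leNgt ss0.
Qed.

(** * The finite-dimensional Hahn-Banach theorem *)

Lemma exists_scalar (R : realType) (X : lmodType R) (f : X -> R) :
  (forall u v, f (u + v) = f u + f v) -> (forall a u, f (a *: u) = a * f u) ->
  exists l : {scalar X}, forall u, l u = f u.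
Proof.
move=> fD fZ.
have f_lin : scalar f by move=> a u v; rewrite fD fZ.
pose l : {scalar X} := HB.pack f (GRing.isLinear.Build R X R *%R f f_lin).
by exists l.
Qed.

Definition sublinear (R : realType) (X : lmodType R) (p : X -> R) :=
  (forall u v, p (u + v) <= p u + p v) /\
  (forall a u, 0 <= a -> p (a *: u) = a * p u).

Lemma sublinear0 (R : realType) (X : lmodType R) (p : X -> R) :
  sublinear p -> p 0 = 0.
Proof. by move=> [_ pZ]; rewrite -(scale0r 0) pZ// mul0r. Qed.

Lemma sublinear_odd_le (R : realType) (X : lmodType R) (p : X -> R) u :
  sublinear p -> p u + p (- u) <= 0 -> p (- u) = - p u.
Proof.
move=> sp le0; apply/eqP; rewrite eq_le; apply/andP; split; first by lra.
by have := sp.1 u (- u); rewrite subrr sublinear0//; lra.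
Qed.

(** The infimum of [p (u + t e) - t p e] over [t >= 0] makes [p] linear along
    [e] while keeping it sublinear.  Doing so for every vector of a basis
    linearizes [p] entirely. *)
Lemma sublinear_tilt (R : realType) (X : lmodType R) (p : X -> R) (e : X) :
  sublinear p -> exists q, [/\ sublinear q, forall u, q u <= p u &
    q (- e) <= - p e].
Proof.
move=> sp; have [pD pZ] := sp.
pose S u := [set p (u + t *: e) - t * p e | t in [set t | 0 <= t]].
pose q u := inf (S u).
have Slb u : lbound (S u) (- p (- u)).
  move=> _ [t /= t0 <-]; rewrite -pZ//.
  have := pD (u + t *: e) (- u); rewrite addrAC subrr add0r; lra.
have Sinf u : has_inf (S u).
  by split; [exists (p (u + 0 *: e) - 0 * p e), 0 => //=|exists (- p (- u))].
have q_le u t : 0 <= t -> q u <= p (u + t *: e) - t * p e.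
  by move=> t0; apply: ge_inf; [exact: (Sinf u).2|exists t].
have le_q u c : (forall t, 0 <= t -> c <= p (u + t *: e) - t * p e) -> c <= q u.
  move=> H; apply: lb_le_inf; first exact: (Sinf u).1.
  by move=> _ [t /= t0 <-]; exact: H.
have qp u : q u <= p u.
  by have := q_le u 0 (lexx _); rewrite scale0r addr0 mul0r subr0.
have qZ_le a u : 0 < a -> q (a *: u) <= a * q u.
  move=> a0; rewrite mulrC -ler_pdivrMr//; apply: le_q => t t0.
  rewrite ler_pdivrMr//.
  have := q_le (a *: u) (a * t) (mulr_ge0 (ltW a0) t0).
  by rewrite -scalerA -scalerDr pZ ?(ltW a0)//; lra.
exists q; split => //; last first.
  by have := q_le (- e) 1 ler01; rewrite scale1r addNr sublinear0// mul1r add0r.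
split.
- move=> u v; rewrite -lerBlDl; apply: (le_q) => t t0.
  rewrite lerBlDr -lerBlDl; apply: le_q => s s0.
  rewrite lerBlDl; apply: (le_trans (q_le _ _ (addr_ge0 t0 s0))).
  have := pD (u + s *: e) (v + t *: e).
  rewrite [u + _ + _]addrACA -scalerDl [s + t]addrC mulrDl; lra.
- move=> a u; rewrite le_eqVlt => /predU1P[<-|a0].
    rewrite scale0r mul0r; apply/eqP; rewrite eq_le; apply/andP; split.
      by rewrite (le_trans (qp _))// sublinear0.
    by apply: le_q => t t0; rewrite add0r pZ// subrr.
  apply/eqP; rewrite eq_le qZ_le//=.
  have := qZ_le a^-1 (a *: u); rewrite invr_gt0 => /(_ a0).
  by rewrite scalerA mulVf ?gt_eqF// scale1r mulrC ler_pdivlMr// mulrC.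
Qed.

(** Once a sublinear functional is odd at a vector, every sublinear functional
    below it is odd there too, so the tilts for successive vectors accumulate. *)
Lemma sublinear_odd_on (R : realType) (X : lmodType R) (s : seq X) (p : X -> R) :
  sublinear p -> exists q, [/\ sublinear q, forall u, q u <= p u &
    forall e, e \in s -> q (- e) = - q e].
Proof.
elim: s p => [|e s IH] p sp; first by exists p.
have [q1 [sq1 q1p q1e]] := sublinear_tilt e sp.
have [q [sq qq1 qs]] := IH _ sq1.
exists q; split=> // [u|u]; first exact: le_trans (qq1 _) (q1p _).
rewrite inE => /predU1P[->|/qs//]; apply: sublinear_odd_le => //.
by have := qq1 e; have := qq1 (- e); have := q1p e; lra.
Qed.

Lemma finite_dim_iso (R : realType) (X : lmodType R) (n : nat) :
  Vector.axiom n X ->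
  exists (f : {linear X -> 'rV[R]_n}) (g : {linear 'rV[R]_n -> X}),
    cancel f g /\ cancel g f.
Proof.
move=> [f0 f0_lin [g0 gK fK]].
pose f : {linear X -> 'rV[R]_n} :=
  HB.pack f0 (GRing.isLinear.Build R X 'rV[R]_n *:%R f0 f0_lin).
have g0_lin : linear g0 by exact: (@can2_linear _ _ _ f g0 gK fK).
pose g : {linear 'rV[R]_n -> X} :=
  HB.pack g0 (GRing.isLinear.Build R 'rV[R]_n X *:%R g0 g0_lin).
by exists f, g.
Qed.

Lemma finite_dim_basis (R : realType) (X : lmodType R) (n : nat) :
  Vector.axiom n X -> exists (b : 'I_n -> X) (c : 'I_n -> {scalar X}),
    forall u, u = \sum_i c i u *: b i.
Proof.
move=> /finite_dim_iso[f [g [gK fK]]].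
have cP i : exists l : {scalar X}, forall u, l u = f u 0 i.
  by apply: exists_scalar => [u v|a u]; rewrite ?linearD ?linearZ mxE.
have [c cE] := choice cP.
exists (fun i => g (delta_mx 0 i)), c => u.
rewrite -[LHS]gK {1}[f u]row_sum_delta linear_sum; apply: eq_bigr => i _.
by rewrite linearZ cE.
Qed.

(** Tilting first along [v] gives [q1 (- v) <= - p v], which forces the value at
    [v]; a sublinear functional that is odd on a basis is linear. *)
Theorem hahn_banach_finite_dim (R : realType) (X : lmodType R) (n : nat)
    (p : X -> R) (v : X) :
  Vector.axiom n X -> sublinear p ->
  exists l : {scalar X}, (forall u, l u <= p u) /\ l v = p v.
Proof.
move=> /finite_dim_basis[b [c bc]] sp.
have [q1 [sq1 q1p q1v]] := sublinear_tilt v sp.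
have [q [sq qq1 qodd]] := sublinear_odd_on (codom b) sq1.
have [qD qZ] := sq.
have qoddD u w : q (- u) = - q u -> q (- w) = - q w -> q (- (u + w)) = - q (u + w).
  move=> qu qw; apply: sublinear_odd_le => //.
  by have := qD u w; have := qD (- u) (- w); rewrite -opprD; lra.
have qoddZ a u : q (- u) = - q u -> q (- (a *: u)) = - q (a *: u).
  move=> qu; have [a0|/ltW a0] := leP 0 a.
    by rewrite -scalerN !qZ// qu mulrN.
  have -> : - (a *: u) = (- a) *: u by rewrite scaleNr.
  have -> : a *: u = (- a) *: (- u) by rewrite scaleNr scalerN opprK.
  by rewrite !qZ ?oppr_ge0// qu; lra.
have qoddT u : q (- u) = - q u.
  rewrite (bc u); elim: (index_enum _) => [|i s IH].
    by rewrite big_nil oppr0 sublinear0// oppr0.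
  by rewrite big_cons; apply: qoddD => //; apply: qoddZ; apply: qodd; exact: codom_f.
have qDE u w : q (u + w) = q u + q w.
  apply/eqP; rewrite eq_le qD/=.
  by have := qD (u + w) (- w); rewrite addrK qoddT; lra.
have qZE a u : q (a *: u) = a * q u.
  have [a0|/ltW a0] := leP 0 a; first exact: qZ.
  have := qoddT (a *: u); rewrite -scaleNr qZ ?oppr_ge0//; lra.
have [l lE] := exists_scalar qDE qZE.
exists l; split=> [u|]; rewrite lE; first exact: le_trans (qq1 _) (q1p _).
apply/eqP; rewrite eq_le (le_trans (qq1 _))//=.
by have := qq1 (- v); rewrite qoddT; lra.
Qed.

(** * Finite-dimensional normed spaces *)

Lemma coord_le_norm (R : realType) (n : nat) (w : 'rV[R]_n) i : `|w 0 i| <= `|w|.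
Proof.
rewrite [leRHS]/Num.norm /= mx_normrE.
by apply/bigmax_geP; right => /=; exists (0, i).
Qed.

(** All norms on a finite-dimensional space are equivalent: [u |-> |g u|] is
    continuous and positive on the compact unit sphere of ['rV_n], hence bounded
    below there by a positive constant. *)
Lemma finite_dim_norm_le (R : realType) (X : normedModType R) (n : nat)
    (f : {linear X -> 'rV[R]_n}) (g : {linear 'rV[R]_n -> X}) :
  cancel f g -> cancel g f ->
  exists2 m : R, 0 < m & forall u, `|f u| <= m * `|u|.
Proof.
move=> gK fK.
pose K := \sum_i `|g (delta_mx 0 i)| + 1.
have K0 : 0 < K by rewrite ltr_wpDl// sumr_ge0.
have gK_le w : `|g w| <= K * `|w|.
  rewrite [w in g w]row_sum_delta linear_sum (le_trans (ler_norm_sum _ _ _))//.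
  rewrite mulrDl mulr_suml mul1r; apply: ler_wpDr => //.
  apply: ler_sum => i _; rewrite linearZ normrZ mulrC ler_wpM2l//.
  exact: coord_le_norm.
pose S := [set w : 'rV[R]_n | `|w| = 1].
have Sunit u : f u != 0 -> S (`|f u|^-1 *: f u).
  by move=> u0; rewrite /S/= normrZ normfV normr_id mulVf// normr_eq0.
(* The sphere is empty exactly when n = 0; then f vanishes identically. *)
have [S0|S0] := pselect (S !=set0); last first.
  exists 1 => // u; have [->|u0] := eqVneq (f u) 0; first by rewrite normr0 mul1r.
  by exfalso; apply: S0; exists (`|f u|^-1 *: f u); exact: Sunit.
have cN : continuous (fun w : 'rV[R]_n => `|g w|).
  move=> w; have FF : Filter (nbhs w) by exact: nbhs_filter.
  apply/(@cvgrPdist_le _ _ _ (nbhs w) FF) => e e0.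
  have eK : 0 < e / K by exact: divr_gt0.
  apply: filterS (nbhsx_ballx w _ eK) => w'; rewrite -ball_normE /= => /ltW ww'.
  apply: (le_trans (ler_dist_dist _ _)); rewrite -linearB.
  by apply: (le_trans (gK_le _)); rewrite mulrC -ler_pdivlMr.
have cS : compact S.
  apply: bounded_closed_compact.
    by exists 1; split=> // x x1 w /= ->; exact: ltW.
  have -> : S = (@Num.norm _ _) @^-1` [set 1 : R] by [].
  apply: closed_comp => [w _|]; first exact: norm_continuous.
  exact: closed_eq.
have [w /= Sw wmin] := EVT_min_rV S0 cS (continuous_subspaceT cN).
have gw0 : 0 < `|g w|.
  rewrite normr_gt0; apply/eqP => gw.
  have w_0 : w = 0 by rewrite -(fK w) gw linear0.
  by move: Sw; rewrite inE /S/= w_0 normr0 => /esym/eqP; rewrite oner_eq0.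
exists `|g w|^-1; first by rewrite invr_gt0.
move=> u; have [->|u0] := eqVneq (f u) 0.
  by rewrite normr0 mulr_ge0// invr_ge0.
have fu0 : 0 < `|f u| by rewrite normr_gt0.
have := wmin _ (mem_set (Sunit _ u0)).
rewrite linearZ gK normrZ normfV normr_id => le1.
by rewrite mulrC ler_pdivlMr// mulrC -ler_pdivlMr// mulrC.
Qed.

Lemma finite_dim_bounded (R : realType) (X : normedModType R) (n : nat)
    (l : {scalar X}) : Vector.axiom n X ->
  exists2 K : R, 0 < K & forall v, `|l v| <= K * `|v|.
Proof.
move=> /finite_dim_iso[f [g [gK fK]]].
have [m m0 fm] := finite_dim_norm_le gK fK.
pose K := \sum_i `|l (g (delta_mx 0 i))|.
have K0 : 0 <= K by exact: sumr_ge0.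
exists ((K + 1) * m); first by rewrite mulr_gt0// ltr_wpDl.
move=> v; rewrite -mulrA; apply: (@le_trans _ _ (K * `|f v|)); last first.
  by apply: ler_pM => //; rewrite lerDl.
rewrite -{1}[v]gK {1}[f v]row_sum_delta !linear_sum mulr_suml.
rewrite (le_trans (ler_norm_sum _ _ _))//; apply: ler_sum => i _.
by rewrite linearZ scalarZ normrM mulrC ler_wpM2l// coord_le_norm.
Qed.

Lemma finite_dim_complete (R : realType) (X : normedModType R) (n : nat)
    (u : nat -> X) : Vector.axiom n X ->
  (forall e : R, 0 < e ->
     exists k, forall j, (k <= j)%N -> `|u j - u k| <= e) ->
  exists l : X, u k @[k --> \oo] --> l.
Proof.
move=> dimX ucau; have [b [c bc]] := finite_dim_basis dimX.
have cK i : exists l : R, (c i (u k)) @[k --> \oo] --> l.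
  have [K K0 cK] := finite_dim_bounded (c i) dimX.
  apply/cvg_ex/cauchy_cvgP/cauchy_exP => e e0.
  have [|k kP] := ucau (e / (2 * K)); first by rewrite divr_gt0// mulr_gt0.
  exists (c i (u k)); exists k => // j /= kj.
  rewrite /ball/= -linearB (le_lt_trans (cK _))//.
  rewrite distrC (@le_lt_trans _ _ (K * (e / (2 * K))))//.
    by rewrite ler_wpM2l ?(ltW K0)// kP.
  have -> : K * (e / (2 * K)) = e / 2 by field; rewrite gt_eqF.
  by rewrite ltr_pdivrMr// ltr_pMr// ltr1n.
have [l lP] := choice cK.
exists (\sum_i l i *: b i).
have -> : u = (fun k => \sum_i c i (u k) *: b i) by apply/funext => k; exact: bc.
apply: cvg_big => [|i _]; first exact: add_continuous.
by apply: cvgZr_tmp; exact: lP.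
Qed.

(** Coordinatewise, this is the fundamental theorem of calculus for the
    integral from [- d], corrected by a constant. *)
Lemma finite_dim_primitive (R : realType) (X : normedModType R) (n : nat)
    (g : R -> X) (d : R) : Vector.axiom n X -> continuous g ->
  exists G : R -> X, G 0 = 0 /\ forall t, - d < t < d -> is_derive t 1 G (g t).
Proof.
move=> dimX cg; have [b [c bc]] := finite_dim_basis dimX.
have Gi i : exists G : R -> R, G 0 = 0 /\
    forall t : R, - d < t < d -> is_derive t 1 G (c i (g t)).
  have [K K0 cK] := finite_dim_bounded (c i) dimX.
  have cc : continuous (c i \o g).
    move=> t; apply/cvgrPdist_le => e e0; near=> s.
    rewrite /= -linearB (le_trans (cK _))// mulrC -ler_pdivlMr//.
    by near: s; apply: cvgr_dist_le; [exact: cg|rewrite divr_gt0].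
  pose F y := (\int[lebesgue_measure]_(t in `[- d, y]) ((c i \o g) t))%R.
  exists (fun t => F t - F 0); split; first exact: subrr.
  move=> t /andP[dt td].
  have [] := @continuous_FTC1_closed R (c i \o g) (- d) t d td _ dt (cc t).
    apply: continuous_compact_integrable; first exact: segment_compact.
    exact: continuous_subspaceT.
  rewrite -/F => dF F'.
  have : is_derive t 1 F (c i (g t)) by split; [exact: dF|rewrite -derive1E; exact: F'].
  move=> H; have := @is_deriveB _ _ _ _ (cst (F 0)) t 1 _ 0 H (is_derive_cst _ _ _).
  by rewrite subr0.
have [G GP] := choice Gi.
exists (fun t => \sum_i G i t *: b i); split.
  by apply: big1 => i _; rewrite (GP i).1 scale0r.
move=> t td; rewrite (bc (g t)).
have -> : (fun t => \sum_i G i t *: b i) = \sum_i (fun t => G i t *: b i).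
  by apply/funext => s; rewrite fct_sumE.
apply: is_derive_sum => i.
have /is_derive1_littleP H := (GP i).2 t td.
apply/is_derive1_littleP => e e0.
have b0 : 0 < `|b i| + 1 by rewrite ltr_wpDl.
near=> h.
have : `|G i (t + h) - G i t - h *: c i (g t)| <= e / (`|b i| + 1) * `|h|.
  by near: h; apply: H; rewrite divr_gt0.
have -> : G i (t + h) *: b i - G i t *: b i - h *: (c i (g t) *: b i) =
   (G i (t + h) - G i t - h *: c i (g t)) *: b i.
  by rewrite !scalerBl scalerA.
rewrite normrZ => le1.
apply: (le_trans (ler_wpM2r _ le1)) => //.
rewrite mulrAC ler_wpM2r// mulrAC -mulrA -[leRHS]mulr1 ler_wpM2l ?(ltW e0)//.
by rewrite ltW// ltr_pdivrMr// mul1r ltrDl.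
Unshelve. all: by end_near. Qed.

(** * Existence of solutions of differential equations *)

Section ODE.
Context (R : realType) (X : normedModType R) (n : nat) (dimX : Vector.axiom n X).

Lemma norm_functional (v : X) : exists l : {scalar X},
  (forall u, `|l u| <= 1 * `|u|) /\ l v = `|v|.
Proof.
have sn : sublinear (fun u : X => `|u|).
  by split=> [u w|a u a0]; [exact: ler_normD|rewrite normrZ ger0_norm].
have [l [l_le lv]] := hahn_banach_finite_dim v dimX sn.
exists l; split=> // u; rewrite mul1r ler_norml l_le andbT.
by rewrite -lerN2 opprK -linearN (le_trans (l_le _))// normrN.
Qed.

(** The vector-valued mean value inequality reduces to the real one by composing
    with a functional that norms [f b - f a]. *)
Lemma norm_mvt (f f' : R -> X) (K a b : R) :
  (forall s : R, Num.min a b <= s <= Num.max a b ->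
     is_derive s 1 f (f' s) /\ `|f' s| <= K) ->
  `|f b - f a| <= K * `|b - a|.
Proof.
wlog ab : a b / a <= b => [H|].
  have /orP[|ba fd] := le_total a b; first exact: H.
  by rewrite distrC [`|b - a|]distrC; apply: H => // s; rewrite minC maxC; exact: fd.
rewrite (min_idPl ab) (max_idPr ab) => fd.
have [l [l1 lE]] := norm_functional (f b - f a).
have [||c c01 cE] := @MVT_segment R (l \o f) (l \o f') a b ab.
- move=> s; rewrite in_itv/= => /andP[s1 s2]; apply: is_derive1_lin_comp l1 _.
  by apply: (fd _ _).1; rewrite !ltW.
- apply: derivable_within_continuous => t; rewrite in_itv/= => tab.
  by have [] := is_derive1_lin_comp l1 (fd t tab).1.
rewrite -lE linearB cE ger0_norm ?subr_ge0// ler_wpM2r ?subr_ge0//.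
rewrite (le_trans (ler_norm _))// (le_trans (l1 _))// mul1r.
by apply: (fd _ _).2; rewrite in_itv/= in c01.
Qed.

Lemma C1_locally_lipschitz (D : set X) (phi : X -> X) (x0 : X) :
  open D -> continuously_differentiable_on D phi -> D x0 ->
  exists r L B : R, [/\ 0 < r, 0 < L, 0 < B,
   (forall x, `|x - x0| <= r -> D x /\ `|phi x| <= B) &
   forall x y, `|x - x0| <= r -> `|y - x0| <= r ->
     `|phi x - phi y| <= L * `|x - y|].
Proof.
move=> oD [dphi cphi] Dx0.
have cd : continuous ('d phi x0) by exact: diff_continuous (dphi _ Dx0).
have [K [K0 Kle]] : exists K : R, 0 < K /\ forall v, `|'d phi x0 v| <= K * `|v|.
  have /linear_boundedP [M [_ H]] := continuous_linear_bounded 0 (cd 0).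
  exists (`|M| + 1); split; first by rewrite ltr_wpDl.
  by move=> v; apply: H; rewrite (le_lt_trans (ler_norm _))// ltrDl.
have nD : nbhs x0 D by exact: open_nbhs_nbhs.
have : \forall x \near x0, D x /\ forall v, `|'d phi x v - 'd phi x0 v| <= 1 * `|v|.
  exact: filterI nD (cphi _ Dx0 1 ltr01).
move=> /nbhs_normP[e /= e0 H].
have re : e / 2 < e by lra.
have inb x : `|x - x0| <= e / 2 -> D x /\ forall v, `|'d phi x v - 'd phi x0 v| <= 1 * `|v|.
  by move=> xr; apply: H; rewrite /ball_/= distrC (le_lt_trans xr).
have lip x y : `|x - x0| <= e / 2 -> `|y - x0| <= e / 2 ->
     `|phi x - phi y| <= (K + 1) * `|x - y|.
  move=> xr yr.
  have := @norm_mvt (phi \o (fun s : R => y + s *: (x - y)))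
    (fun s => 'd phi (y + s *: (x - y)) (x - y)) ((K + 1) * `|x - y|) 0 1.
  rewrite /= scale1r subrKC scale0r addr0 subr0 normr1 mulr1; apply.
  move=> s; rewrite (min_idPl ler01) (max_idPr ler01) => /andP[s0 s1].
  have ys : `|y + s *: (x - y) - x0| <= e / 2.
    have -> : y + s *: (x - y) - x0 = (1 - s) *: (y - x0) + s *: (x - x0).
      rewrite [LHS]addrAC scalerBl scale1r -[RHS]addrA; congr (_ + _).
      by rewrite addrC -scalerBr opprB addrA subrK.
    rewrite (le_trans (ler_normD _ _))// !normrZ !ger0_norm ?subr_ge0//.
    nra.
  have [Dy dy] := inb _ ys.
  split.
    apply: is_derive1_diff_comp (is_derive1_line _ _ _) _.
    exact: dphi.
  have -> : 'd phi (y + s *: (x - y)) (x - y) =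
     'd phi x0 (x - y) + ('d phi (y + s *: (x - y)) (x - y) - 'd phi x0 (x - y)).
    by rewrite subrKC.
  by rewrite (le_trans (ler_normD _ _))// mulrDl lerD.
exists (e / 2), (K + 1), (`|phi x0| + (K + 1) * (e / 2)); split.
- by rewrite divr_gt0.
- by rewrite ltr_wpDl// ltW.
- by rewrite ltr_wpDl// mulr_gt0 ?divr_gt0// addr_gt0.
- move=> x xr; split; first exact: (inb x xr).1.
  have x0r : `|x0 - x0| <= e / 2 by rewrite subrr normr0 ltW// divr_gt0.
  rewrite -lerBlDl (le_trans (lerB_dist _ _))// (le_trans (lip _ _ xr x0r))//.
  by rewrite ler_pM2l// addr_gt0.
- exact: lip.
Qed.

(** Clamping the time to [[- d, d]] makes the iterate a continuous curve on the
    whole line that stays in the ball, so that the step can be iterated. *)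
Lemma picard_step (phi : X -> X) (x0 : X) (r L B d : R) :
  0 < r -> 0 < L -> 0 < B -> 0 < d -> B * d <= r ->
  (forall x, `|x - x0| <= r -> `|phi x| <= B) ->
  (forall x y, `|x - x0| <= r -> `|y - x0| <= r ->
     `|phi x - phi y| <= L * `|x - y|) ->
  forall g : R -> X, continuous g -> (forall t, `|g t - x0| <= r) ->
  exists y : R -> X, [/\ continuous y, forall t, `|y t - x0| <= r, y 0 = x0 &
    forall t, - d < t < d -> is_derive t 1 y (phi (g t))].
Proof.
move=> r0 L0 B0 d0 Bdr phiB lip g cg gr.
have cpg : continuous (phi \o g).
  move=> t; apply/cvgrPdist_le => e e0; near=> s.
  rewrite /= (le_trans (lip _ _ (gr _) (gr _)))// mulrC -ler_pdivlMr//.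
  by near: s; apply: cvgr_dist_le; [exact: cg|rewrite divr_gt0].
have [G [G0 Gd]] := finite_dim_primitive (2 * d) dimX cpg.
pose cl (t : R) := Num.max (- d) (Num.min d t).
have cl_in t : - d <= cl t <= d.
  rewrite /cl le_max lexx/= ge_max ge_min lexx/= andbT; lra.
have clE t : - d <= t <= d -> cl t = t.
  by move=> /andP[t1 t2]; rewrite /cl (min_idPr t2) (max_idPr t1).
have ccl : continuous cl.
  move=> t.
  have c1 : {for t, continuous (cst d \min (@id R) : R -> R^o)}.
    by apply: continuous_min; [exact: cst_continuous|exact: cvg_id].
  exact: (continuous_max (@cst_continuous R R^o (- d) t) c1).
have in2 t : - d <= t <= d -> - (2 * d) < t < 2 * d by lra.
exists (fun t => x0 + G (cl t)); split.
- move=> t; apply: cvgD; first exact: cvg_cst.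
  apply: (@continuous_comp _ _ _ cl G); first exact: ccl.
  exact: is_derive1_continuous (Gd _ (in2 _ (cl_in t))).
- move=> t; rewrite addrAC subrr add0r.
  have := cl_in t; set c := cl t => cd.
  have := @norm_mvt G (phi \o g) B 0 c; rewrite G0 !subr0 => H.
  rewrite (le_trans (H _))//.
    move=> s sc; split; last exact: phiB.
    apply: Gd; apply: in2; move: sc; rewrite ge_min le_max => /andP[/orP[] ? /orP[] ?]; lra.
  by rewrite (le_trans _ Bdr)// ler_pM2l// ler_norml.
- by rewrite clE ?G0 ?addr0//; lra.
- move=> t td; have td' : - d <= t <= d by lra.
  apply: (@near_eq_is_derive _ _ _ (fun t => x0 + G t)).
    have td'' : t \in `]- d, d[ by rewrite in_itv.
    near=> s; rewrite clE//.
    have : s \in `]- d, d[ by near: s; exact: near_in_itvoo.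
    by rewrite in_itv/= => /andP[? ?]; rewrite !ltW.
  have := is_deriveD (is_derive_cst x0 t (1 : R)) (Gd t (in2 _ td')).
  by rewrite add0r.
Unshelve. all: by end_near. Qed.

End ODE.

Section Solutions.
Context (R : realType) (X : normedModType R) (n : nat) (dimX : Vector.axiom n X).

(** The Picard iterates converge geometrically because [L d <= 1 / 2].  The limit
    [x] is differentiated without passing to the limit under an integral: the
    mean value inequality for [u k.+1 s - s phi (x t)] bounds the first-order
    remainder of [u k.+1] at [t] by a multiple of [h ^ 2], up to an error that
    vanishes with [k]. *)
Theorem picard_local (D : set X) (phi : X -> X) (x0 : X) :
  open D -> continuously_differentiable_on D phi -> D x0 ->
  exists (d : R) (x : R -> X), [/\ 0 < d, x 0 = x0 &
    forall t, - d < t < d -> D (x t) /\ is_derive t 1 x (phi (x t))].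
Proof.
move=> oD cphi Dx0.
have [r [L [B [r0 L0 B0 ball_phi lip]]]] := C1_locally_lipschitz dimX oD cphi Dx0.
pose d := Num.min (r / B) (1 / (2 * L)).
have d0 : 0 < d by rewrite lt_min !divr_gt0// mulr_gt0.
have Bd : B * d <= r by rewrite mulrC -ler_pdivlMr// ge_min lexx.
have Ld : L * d <= 1 / 2.
  have : d <= 1 / (2 * L) by rewrite ge_min lexx orbT.
  rewrite -(ler_pM2l L0) => /le_trans; apply; rewrite le_eqVlt; apply/orP; left.
  by apply/eqP; field; rewrite gt_eqF.
pose K (g : R -> X) := continuous g /\ forall t, `|g t - x0| <= r.
have Pex (g : R -> X) : exists y : R -> X, K g ->
    [/\ K y, y 0 = x0 & forall t, - d < t < d -> is_derive t 1 y (phi (g t))].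
  have [[cg gr]|nKg] := pselect (K g); last by exists g.
  have [y [cy yr y0 yd]] := picard_step dimX r0 L0 B0 d0 Bd
    (fun x xr => (ball_phi x xr).2) lip cg gr.
  by exists y => _; split.
have [P PP] := choice Pex.
pose u k := iter k P (cst x0).
have uK k : K (u k).
  elim: k => [|k IH]; last by have [] := PP _ IH.
  by split=> [|t]; [exact: cst_continuous|rewrite subrr normr0 ltW].
have uS k t : - d < t < d -> is_derive t 1 (u k.+1) (phi (u k t)).
  by have [_ _] := PP _ (uK k); exact.
have u0 k : u k 0 = x0 by case: k => // k; have [] := PP _ (uK k).
have btw a b s : - d < a < d -> - d < b < d ->
    Num.min a b <= s <= Num.max a b -> - d < s < d.
  move=> ad bd; rewrite ge_min le_max => /andP[/orP[] ? /orP[] ?]; lra.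
have zd : - d < 0 < d by rewrite d0 oppr_lt0 d0.
have ustep k t : - d < t < d -> `|u k.+1 t - u k t| <= r * 2^-1 ^+ k.
  elim: k t => [t _|k IH t td]; first by rewrite expr0 mulr1; exact: (uK 1%N).2.
  have := @norm_mvt R X n dimX (fun t => u k.+2 t - u k.+1 t)
    (fun t => phi (u k.+1 t) - phi (u k t)) (L * (r * 2^-1 ^+ k)) 0 t.
  rewrite !u0 subrr !subr0 => H.
  rewrite (le_trans (H _))//.
    move=> s /(btw _ _ _ zd td) sd; split; first exact: is_deriveB (uS _ _ sd) (uS _ _ sd).
    rewrite (le_trans (lip _ _ ((uK _).2 _) ((uK _).2 _)))// ler_pM2l//.
    exact: IH.
  have t_d : `|t| <= d by rewrite ler_norml; lra.
  have q0 : 0 < r * 2^-1 ^+ k by rewrite mulr_gt0// exprn_gt0.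
  rewrite exprSr (mulrA r); set q := r * _ in q0 *.
  have -> : L * q * `|t| = q * (L * `|t|) by ring.
  rewrite ler_pM2l// (le_trans _ (_ : L * d <= _))//; last by lra.
  by rewrite ler_pM2l.
have ucau k m t : - d < t < d ->
    `|u (k + m)%N t - u k t| <= 2 * r * (2^-1 ^+ k - 2^-1 ^+ (k + m)).
  move=> td; elim: m => [|m IH]; first by rewrite addn0 !subrr normr0 mulr0.
  have -> : u (k + m.+1)%N t - u k t = (u (k + m).+1 t - u (k + m)%N t) + (u (k + m)%N t - u k t).
    by rewrite addnS addrA subrK.
  rewrite (le_trans (ler_normD _ _))//.
  have := ustep (k + m)%N t td; rewrite addnS exprS; lra.
have half0 (k : nat) : 0 < (2^-1 : R) ^+ k by rewrite exprn_gt0.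
have small (e : R) : 0 < e -> exists k, 2 * r * 2^-1 ^+ k <= e.
  move=> e0.
  have /cvgrPdist_le /(_ (e / (2 * r))) : (fun k => (2^-1 : R) ^+ k) @ \oo --> (0 : R).
    by apply: cvg_expr; rewrite ger0_norm ?invr_ge0// invf_lt1// ltr1n.
  rewrite divr_gt0 ?mulr_gt0// => /(_ isT)[k _ /(_ k (leqnn k))] /=.
  rewrite sub0r normrN gtr0_norm// => H; exists k.
  by rewrite mulrC -ler_pdivlMr// mulr_gt0.
have xex (t : R) : exists l : X, - d < t < d -> u k t @[k --> \oo] --> l.
  have [td|ntd] := boolP (- d < t < d); last by exists x0.
  have [l ul] : exists l : X, u k t @[k --> \oo] --> l.
    apply: (finite_dim_complete dimX) => e e0; have [k ke] := small e e0.
    exists k => j kj; rewrite -(subnKC kj) (le_trans (ucau _ _ _ td))//.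
    apply: le_trans ke; rewrite ler_pM2l ?mulr_gt0//.
    by rewrite lerBlDr lerDl ltW.
  by exists l.
have [x xP] := choice xex.
have xu k t : - d < t < d -> `|x t - u k t| <= 2 * r * 2^-1 ^+ k.
  move=> td; apply/ler_addgt0Pl => e e0.
  have /cvgrPdist_le /(_ e e0)[N _ /(_ (k + N)%N (leq_addl _ _))] := xP t td.
  rewrite /= => H.
  have -> : x t - u k t = (x t - u (k + N)%N t) + (u (k + N)%N t - u k t).
    by rewrite addrA subrK.
  rewrite (le_trans (ler_normD _ _))// lerD//.
  rewrite (le_trans (ucau _ _ _ td))// ler_pM2l ?mulr_gt0//.
  by rewrite lerBlDr lerDl ltW.
have xr t : - d < t < d -> `|x t - x0| <= r.
  move=> td; apply/ler_addgt0Pl => e e0; have [k ke] := small e e0.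
  have -> : x t - x0 = (x t - u k t) + (u k t - x0) by rewrite addrA subrK.
  rewrite (le_trans (ler_normD _ _))// lerD//; last exact: (uK _).2.
  by rewrite (le_trans (xu _ _ td)).
have x_0 : x 0 = x0.
  apply/eqP; rewrite -subr_eq0 -normr_le0; apply/ler_addgt0Pl => e e0; rewrite addr0.
  by have [k ke] := small e e0; have := xu k 0 zd; rewrite u0 => /le_trans; apply.
have ulip k s t : - d < s < d -> - d < t < d -> `|u k t - u k s| <= B * `|t - s|.
  case: k => [_ _|k sd td]; first by rewrite subrr normr0 mulr_ge0// ltW.
  apply: (norm_mvt dimX (f' := fun t => phi (u k t))) => w /(btw _ _ _ sd td) wd.
  by split; [exact: uS|exact: (ball_phi _ ((uK _).2 _)).2].
exists d, x; split => // t td; split; first exact: (ball_phi _ (xr t td)).1.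
apply/is_derive1_littleP => e e0.
have main (h : R) : - d < t + h < d ->
    `|x (t + h) - x t - h *: phi (x t)| <= L * B * `|h| * `|h|.
  move=> thd; apply/ler_addgt0Pl => e1 e10.
  (* [e2] bounds the uniform distance to the iterates, which enters the remainder
     twice directly and once multiplied by [L |h|]. *)
  pose e2 := e1 / (L * `|h| + 2).
  have Lh : 0 < L * `|h| + 2 by rewrite ltr_wpDl// mulr_ge0// ltW.
  have [k ke] := small e2 (divr_gt0 e10 Lh).
  have ke' : 2 * r * 2^-1 ^+ k.+1 <= e2.
    apply: le_trans ke; rewrite ler_pM2l ?mulr_gt0// exprS; have := half0 k; lra.
  have H : `|(u k.+1 (t + h) - (t + h) *: phi (x t)) - (u k.+1 t - t *: phi (x t))|
      <= L * (B * `|h| + e2) * `|t + h - t|.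
    apply: (norm_mvt dimX (f := fun s => u k.+1 s - s *: phi (x t))
      (f' := fun s => phi (u k s) - phi (x t))) => s sth.
    have sd := btw _ _ _ td thd sth.
    split.
      have d1 := is_derive1_line (0 : X) (phi (x t)) s.
      have -> : (fun s => u k.+1 s - s *: phi (x t)) = u k.+1 - (fun s => 0 + s *: phi (x t)).
        by apply/funext => w; rewrite !fctE add0r.
      exact: is_deriveB (uS _ _ sd) d1.
    rewrite (le_trans (lip _ _ ((uK _).2 _) (xr _ td)))// ler_pM2l//.
    have -> : u k s - x t = (u k s - u k t) - (x t - u k t) by rewrite opprB addrA subrK.
    rewrite (le_trans (ler_normB _ _))// lerD ?(le_trans (xu _ _ td))//.
    rewrite (le_trans (ulip _ _ _ td sd))// ler_pM2l//.
    have := ler_norm (- h); have := ler_norm h; rewrite normrN ler_norml.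
    by move: sth; rewrite ge_min le_max => /andP[/orP[] ? /orP[] ?]; lra.
  have {}H : `|(u k.+1 (t + h) - (t + h) *: phi (x t)) - (u k.+1 t - t *: phi (x t))|
      <= L * (B * `|h| + e2) * `|h|.
    by move: H; rewrite [t + h - t]addrAC subrr add0r.
  have -> : x (t + h) - x t - h *: phi (x t) =
     (x (t + h) - u k.+1 (t + h)) - (x t - u k.+1 t) +
     (u k.+1 (t + h) - (t + h) *: phi (x t) - (u k.+1 t - t *: phi (x t))).
    rewrite scalerDl; set a := x _; set b := x t; set c := u _ _; set e' := u _ t.
    set f := t *: _; set g := h *: _.
    have -> : c - (f + g) - (e' - f) = (c - e') - g.
      by rewrite opprB [f + g]addrC opprD !addrA subrK addrAC.
    by rewrite opprB addrA [X in _ = X - g]addrAC !addrA !subrK.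
  rewrite (le_trans (ler_normD _ _))//.
  rewrite (le_trans (lerD (ler_normB _ _) (lexx _)))//.
  rewrite (le_trans (lerD (lerD (xu _ _ thd) (xu _ _ td)) H))//.
  have : e2 * (L * `|h| + 2) = e1 by rewrite divfK// gt_eqF.
  have -> : L * (B * `|h| + e2) * `|h| = L * B * `|h| * `|h| + e2 * (L * `|h|) by ring.
  lra.
have LB0 : 0 < L * B by exact: mulr_gt0.
have td' : t \in `]- d, d[ by rewrite in_itv.
have c0 : (t + h) @[h --> (0 : R)] --> t.
  by rewrite -[X in _ --> X]addr0; apply: cvgD; [exact: cvg_cst|exact: cvg_id].
near=> h.
have thd : - d < t + h < d.
  suff : t + h \in `]- d, d[ by rewrite in_itv.
  by near: h; apply: (c0 (fun s => s \in `]- d, d[)); exact: near_in_itvoo.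
rewrite (le_trans (main h thd))// ler_wpM2r// mulrC -ler_pdivlMr//.
near: h; apply/nbhs_normP; exists (e / (L * B)) => [|z /=]; first exact: divr_gt0.
by rewrite sub0r normrN => /ltW.
Unshelve. all: by end_near. Qed.

(** A solution is encoded by its graph, so that extension becomes inclusion and
    the supremum of a chain is a union. *)
Definition graph_on (T : Type) (J : set R) (x : R -> T) : set (R * T) :=
  [set tv | J tv.1 /\ tv.2 = x tv.1].

Lemma is_solution_bigcup (D : set X) (phi : X -> X) (x0 : X)
    (F : set (set (R * X))) :
  (forall G, F G -> exists J x, is_solution phi D x0 J x /\ G = graph_on J x) ->
  total_on F subset -> F !=set0 ->
  exists J x, is_solution phi D x0 J x /\ \bigcup_(G in F) G = graph_on J x.
Proof.
move=> solF totF [G0 FG0].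
pose W := \bigcup_(G in F) G.
have Wfun t v v' : W (t, v) -> W (t, v') -> v = v'.
  move=> [G FG Gv] [G' FG' Gv'].
  have [H [FH Hv Hv']] : exists H, [/\ F H, H (t, v) & H (t, v')].
    by have [GG'|G'G] := totF _ _ FG FG'; [exists G'; split => //; exact: GG'|
      exists G; split => //; exact: G'G].
  have [J [x [_ HE]]] := solF _ FH.
  by move: Hv Hv'; rewrite HE => -[_ /= ->] [_ /= ->].
pose J := [set t | exists v, W (t, v)].
have Jx t : exists v, J t -> W (t, v).
  by have [[v Wv]|nJ] := pselect (J t); [exists v|exists x0].
have [x xP] := choice Jx.
have sub G J' x' : F G -> is_solution phi D x0 J' x' -> G = graph_on J' x' ->
    forall t, J' t -> J t /\ x t = x' t.
  move=> FG _ GE t J't.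
  have Wt : W (t, x' t) by exists G => //; rewrite GE.
  have Jt : J t by exists (x' t).
  by split => //; apply: Wfun (xP _ Jt) Wt.
exists J, x; split; last first.
  apply/seteqP; split => [[t v] Wv|[t v] [/= Jt ->]]; last exact: xP.
  by have Jt : J t; [exists v|split => //=; exact: Wfun Wv (xP _ Jt)].
have JG t : J t -> exists J' x', [/\ is_solution phi D x0 J' x', J' t,
    F (graph_on J' x')  & forall t, J' t -> J t /\ x t = x' t].
  move=> [v [G FG Gv]]; have [J' [x' [sol GE]]] := solF _ FG.
  exists J', x'; split => //; last exact: sub sol GE.
    by move: Gv; rewrite GE => -[].
  by rewrite -GE.
have [J0 [x0' [sol0 GE0]]] := solF _ FG0.
have sub0 := sub _ _ _ FG0 sol0 GE0.
split.
- rewrite openE => t /JG[J' [x' [[oJ' _ _ _ _] J't _ J'J]]].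
  apply: filterS (open_nbhs_nbhs (conj oJ' J't)) => s J's.
  exact: (J'J _ J's).1.
- move=> a b /JG[Ja [xa [sola Jaa Fa subA]]] /JG[Jb [xb [solb Jbb Fb subB]]] c acb.
  have [ab|ba] := totF _ _ Fa Fb.
    have Jba : Jb a by have [] := ab (a, xa a) (conj Jaa erefl).
    by apply: (subB _ _).1; case: solb => _ itv _ _ _; exact: itv Jba Jbb c acb.
  have Jab : Ja b by have [] := ba (b, xb b) (conj Jbb erefl).
  by apply: (subA _ _).1; case: sola => _ itv _ _ _; exact: itv Jaa Jab c acb.
- by apply: (sub0 _ _).1; case: sol0.
- case: sol0 => _ _ J00 x00 _.
  by rewrite (sub0 _ J00).2.
- move=> t /JG[J' [x' [[oJ' _ _ _ sol'] J't _ J'J]]].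
  have [Dx dx] := sol' t J't.
  rewrite (J'J _ J't).2; split=> //.
  apply: near_eq_is_derive dx.
  apply: filterS (open_nbhs_nbhs (conj oJ' J't)) => s J's.
  by rewrite (J'J _ J's).2.
Qed.

(** Zorn's lemma on graphs of solutions.  The empty set is admitted among the
    graphs as the union of the empty chain; it is not maximal because local
    solutions exist. *)
Theorem maximal_solution_exists (D : set X) (phi : X -> X) (x0 : X) :
  open D -> continuously_differentiable_on D phi -> D x0 ->
  is_maximal_solution phi D x0 (maximal_solution phi D x0).
Proof.
move=> oD cphi Dx0; suff : exists s, is_maximal_solution phi D x0 s by exact: xgetPex.
have [d [y [d0 y0 yd]]] := picard_local oD cphi Dx0.
have soly : is_solution phi D x0 `]- d, d[ y.
  split; [exact: interval_open|exact: interval_is_interval| |exact: y0|].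
    by rewrite /= in_itv/= oppr_lt0 d0.
  by move=> t; rewrite /= in_itv/=; exact: yd.
pose P (G : set (R * X)) := G = set0 \/
  exists J x, is_solution phi D x0 J x /\ G = graph_on J x.
have [|A [PA Amax]] := @Zorn_bigcup _ P.
  move=> F FP totF.
  have [F0|nF0] := pselect ((F `\ set0) !=set0); last first.
    left; rewrite -subset0 => tv [G FG Gtv]; apply: nF0; exists G; split => // G0.
    by rewrite G0 in Gtv.
  right; have -> : \bigcup_(G in F) G = \bigcup_(G in F `\ set0) G.
    apply/seteqP; split => tv [G FG Gtv]; exists G => //; last exact: FG.1.
    by split => // G0; rewrite G0 in Gtv.
  apply: is_solution_bigcup => //.
    by move=> G [/FP[G0 nG0|//]]; case: nG0.
  by move=> G G' [FG _] [FG' _]; exact: totF.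
case: PA => [A0|[J [x [solx AE]]]].
  exfalso; apply: (Amax (graph_on `]- d, d[ y)); last first.
    by right; exists `]- d, d[%classic, y.
  rewrite A0; split; first exact: sub0set.
  by move=> /(_ (0, y 0)); apply; split => //=; case: soly.
exists (J, x); split => //= J' x' sol' JJ' xx' t J't; apply: contrapT => nJt.
apply: (Amax (graph_on J' x')); last by right; exists J', x'.
rewrite AE; split => [[s v] [/= Js ->]|H]; first by split => /=; [exact: JJ'|rewrite xx'].
by apply: nJt; have [] := H (t, x' t) (conj J't erefl).
Qed.

End Solutions.

(** * Cones, gauges and the Hilbert metric *)

Lemma convex_set_segment (R : realType) (X : lmodType R) (A : set X) (x y : X)
    (s : R) : convex_set (A : set (convex_lmodType X)) -> A x -> A y ->
  0 <= s <= 1 -> A (y + s *: (x - y)).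
Proof.
move=> cA Ax Ay s01; case/andP: (s01) => s0 s1.
have := cA _ _ (Itv01 s0 s1) (mem_set Ax) (mem_set Ay); rewrite inE.
have -> : conv (Itv01 s0 s1) (x : convex_lmodType X) (y : convex_lmodType X) =
  s *: (x : X) + (1 - s) *: (y : X) by [].
by rewrite scalerBl scale1r scalerBr addrCA.
Qed.

(** The functional written M(x/y) in the theory of Hilbert's metric. *)
Definition gauge (R : realType) (X : normedModType R) (C : set X) (x y : X) : R :=
  inf [set t : R | cone_le C x (t *: y)].

Definition hilbert_metric (R : realType) (X : normedModType R) (C : set X)
    (x y : X) : R :=
  ln (gauge C x y) + ln (gauge C y x).

Section ProperCone.
Context (R : realType) (X : normedModType R) (C : set X).
Context (closedC : closed C) (convexC : convex_set (C : set (convex_lmodType X))).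
Context (coneC : cone C) (pointedC : pointed_cone C).

Lemma coneD x y : C x -> C y -> C (x + y).
Proof.
move=> Cx Cy.
have h01 : 0 <= (2^-1 : R) <= 1 by lra.
have := convex_set_segment convexC Cx Cy h01 => /(coneC (ler0n _ 2)).
rewrite scalerDr scalerA mulfV ?scale1r ?pnatr_eq0// scaler_nat mulr2n.
by rewrite addrAC addrCA subrr addr0 addrC.
Qed.

Lemma interior_ball (A : set X) x : A° x <->
  exists2 e : R, 0 < e & forall v, `|v| < e -> A (x + v).
Proof.
split=> [|[e e0 H]].
  move=> /nbhs_normP[e /= e0 H]; exists e => // v ve; apply: H.
  by rewrite /ball_/= opprD addNKr normrN.
apply/nbhs_normP; exists e => // w /= xw.
by rewrite -[w](subrKC x); apply: H; rewrite distrC.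
Qed.

Lemma cone_interiorD x y : C° x -> C y -> C° (x + y).
Proof.
move=> /interior_ball[e e0 H] Cy; apply/interior_ball; exists e => // v ve.
by rewrite addrAC; apply: coneD => //; exact: H.
Qed.

Lemma cone_interiorZ l x : 0 < l -> C° x -> C° (l *: x).
Proof.
move=> l0 /interior_ball[e e0 H]; apply/interior_ball.
exists (l * e); first exact: mulr_gt0.
move=> v ve; have -> : l *: x + v = l *: (x + l^-1 *: v).
  by rewrite scalerDr scalerA mulfV ?gt_eqF// scale1r.
apply: coneC; first exact: ltW.
by apply: H; rewrite normrZ gtr0_norm ?invr_gt0// ltr_pdivrMl.
Qed.

Lemma cone_absorbing x v : C° x -> exists2 t : R, 0 < t & C (t *: x - v).
Proof.
move=> /interior_ball[e e0 H]; pose t := (`|v| + 1) / e.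
have t0 : 0 < t by rewrite divr_gt0// ltr_wpDl.
exists t => //; have -> : t *: x - v = t *: (x - t^-1 *: v).
  by rewrite scalerBr scalerA mulfV ?gt_eqF// scale1r.
apply: coneC; first exact: ltW.
apply: H; rewrite normrN normrZ gtr0_norm ?invr_gt0// ltr_pdivrMl//.
by rewrite /t divfK ?gt_eqF// ltrDl.
Qed.

Lemma cone_opp_eq0 x : C x -> C (- x) -> x = 0.
Proof.
move=> Cx CNx; have : (C `&` [set - x | x in C]) x.
  by split=> //; exists (- x) => //; rewrite opprK.
by rewrite pointedC.
Qed.

Lemma dual_interior_gt0 (mu : {scalar X}) x v :
  dual_cone C mu -> C° x -> mu v != 0 -> 0 < mu x.
Proof.
move=> mu0 Cx muv.
have [t t0 /mu0] := cone_absorbing v Cx.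
have [s s0 /mu0] := cone_absorbing (- v) Cx.
rewrite opprK linearD linearB !scalarZ => h1 h2.
have : mu v < 0 \/ 0 < mu v by apply/orP; rewrite -neq_lt.
by case=> h; [rewrite -(pmulr_rgt0 _ s0)|rewrite -(pmulr_rgt0 _ t0)]; lra.
Qed.

Lemma normalized_dual_gt0 (mu : {scalar X}) x y :
  normalized_dual C y mu -> C° x -> 0 < mu x.
Proof.
move=> [mu0 muy] Cx; apply: (dual_interior_gt0 mu0 Cx (v := y)).
by rewrite muy oner_eq0.
Qed.

(** The origin is interior to a pointed cone only in dimension 0.  The Hilbert
    distance then takes the value [-oo], and that case is handled apart. *)
Lemma trivial_cone : C° 0 -> forall x : X, x = 0.
Proof.
move=> C0 x; have [t t0] := cone_absorbing x C0; rewrite scaler0 add0r => CNx.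
have [s s0] := cone_absorbing (- x) C0; rewrite scaler0 add0r opprK => Cx.
exact: cone_opp_eq0.
Qed.

Context (properC : ~ C° 0).

Lemma interior_oppN y : C° y -> ~ C (- y).
Proof. by move=> Cy /(cone_interiorD Cy); rewrite subrr. Qed.

Lemma cone_scale_ge0 t y : C° y -> C (t *: y) -> 0 <= t.
Proof.
move=> Cy Cty; rewrite leNgt; apply/negP => t0; apply: (interior_oppN Cy).
have -> : - y = (- t)^-1 *: (t *: y).
  by rewrite scalerA invrN mulNr mulVf ?lt_eqF// scaleN1r.
by apply: coneC => //; rewrite invr_ge0 oppr_ge0 ltW.
Qed.

Lemma gauge_has_inf x y : C° y -> has_inf [set t : R | cone_le C x (t *: y)].
Proof.
move=> Cy; split; first by have [t t0 Ct] := cone_absorbing x Cy; exists t.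
have [s s0 Cs] := cone_absorbing (- x) Cy; exists (- s) => t /= Ct.
rewrite -subr_ge0 opprK; apply: (cone_scale_ge0 Cy).
by have := coneD Ct Cs; rewrite opprK addrACA addNr addr0 scalerDl.
Qed.

Lemma gauge_le x y t : C° y -> C (t *: y - x) -> gauge C x y <= t.
Proof. by move=> Cy Ct; apply: ge_inf => //; exact: (gauge_has_inf x Cy).2. Qed.

(** The infimum is attained since the cone is closed. *)
Lemma gauge_mem x y : C° y -> C (gauge C x y *: y - x).
Proof.
move=> Cy; apply: contrapT => nC.
have : (~` C)° (gauge C x y *: y - x).
  have : open (~` C) by exact: closed_openC.
  by rewrite openE => /(_ _ nC).
move=> /interior_ball[e e0 H].
have y0 : 0 < `|y| + 1 by rewrite ltr_wpDl.
have [t Ct tg] := inf_adherent (divr_gt0 e0 y0) (gauge_has_inf x Cy).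
have gt := gauge_le Cy Ct.
apply: (H ((t - gauge C x y) *: y)).
  rewrite normrZ ger0_norm ?subr_ge0//.
  apply: (@le_lt_trans _ _ (e / (`|y| + 1) * `|y|)).
    by rewrite ler_wpM2r// lerBlDl ltW.
  by rewrite mulrAC ltr_pdivrMr// ltr_pM2l// ltrDl.
have -> : gauge C x y *: y - x + (t - gauge C x y) *: y = t *: y - x; last exact: Ct.
by rewrite addrAC -scalerDl subrKC.
Qed.

Lemma gauge_gt0 x y : C° x -> C° y -> 0 < gauge C x y.
Proof.
move=> Cx Cy; rewrite ltNge; apply/negP => g0; apply: (interior_oppN Cx).
have CNg : C ((- gauge C x y) *: y).
  by apply: coneC; [rewrite oppr_ge0|exact: interior_subset].
have := coneD CNg (gauge_mem x Cy).
by rewrite addrA -scalerDl addNr scale0r add0r.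
Qed.

Lemma gauge_sublinear y : C° y -> sublinear (fun x => gauge C x y).
Proof.
move=> Cy; split=> [u v|a u].
  apply: gauge_le => //.
  have := coneD (gauge_mem u Cy) (gauge_mem v Cy).
  by rewrite addrACA -opprD -scalerDl.
have gZ b w : 0 <= b -> gauge C (b *: w) y <= b * gauge C w y.
  move=> b0; apply: gauge_le => //.
  by rewrite -scalerA -scalerBr; apply: coneC => //; exact: gauge_mem.
have g0 : gauge C 0 y = 0.
  apply/eqP; rewrite eq_le; apply/andP; split.
    by rewrite -(scale0r 0) (le_trans (gZ _ _ _))// mul0r.
  by apply: (cone_scale_ge0 Cy); have := gauge_mem 0 Cy; rewrite subr0.
rewrite le_eqVlt => /predU1P[<-|a0]; first by rewrite scale0r mul0r.
apply/eqP; rewrite eq_le gZ ?(ltW a0)//=.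
have := gZ a^-1 (a *: u); rewrite invr_ge0 => /(_ (ltW a0)).
by rewrite scalerA mulVf ?gt_eqF// scale1r mulrC ler_pdivlMr// mulrC.
Qed.

(** Hahn-Banach for the sublinear functional [gauge C . y]: a linear functional
    below it is nonpositive on [- C], hence in the dual cone, and squeezed to the
    value 1 at [y]. *)
Lemma gauge_attained n x y : Vector.axiom n X -> C° y ->
  exists mu : {scalar X}, normalized_dual C y mu /\ mu x = gauge C x y.
Proof.
move=> dimX Cy.
have [mu [mu_le muE]] := hahn_banach_finite_dim x dimX (gauge_sublinear Cy).
have muC : dual_cone C mu.
  move=> c Cc; rewrite -oppr_le0 -linearN (le_trans (mu_le _))//.
  by apply: gauge_le => //; rewrite scale0r sub0r opprK.
exists mu; split => //; split => //.
have C0 : C 0 by rewrite -(scale0r y); apply: coneC => //; exact: interior_subset.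
apply/eqP; rewrite eq_le; apply/andP; split.
  by rewrite (le_trans (mu_le _))//; apply: gauge_le => //; rewrite scale1r subrr.
rewrite -lerN2 -linearN (le_trans (mu_le _))//; apply: gauge_le => //.
by rewrite scaleN1r subrr.
Qed.

Lemma dual_le_gauge (mu : {scalar X}) x y : dual_cone C mu -> C° y ->
  mu x <= gauge C x y * mu y.
Proof.
by move=> mu0 Cy; have := mu0 _ (gauge_mem x Cy); rewrite linearB scalarZ subr_ge0.
Qed.

Lemma ln_dual_le_gauge (mu : {scalar X}) x y : dual_cone C mu ->
  0 < mu x -> 0 < mu y -> C° x -> C° y ->
  ln (mu x) - ln (mu y) <= ln (gauge C x y).
Proof.
move=> mu0 mux muy Cx Cy; rewrite lerBlDr -lnM ?posrE ?gauge_gt0//.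
by rewrite ler_ln ?posrE ?mulr_gt0 ?gauge_gt0//; exact: dual_le_gauge.
Qed.

Lemma hilbert_distE x y : C° x -> C° y ->
  hilbert_dist C x y = (hilbert_metric C x y)%:E.
Proof.
move=> Cx Cy; have g1 := gauge_gt0 Cx Cy; have g2 := gauge_gt0 Cy Cx.
rewrite /hilbert_dist /hilbert_metric.
have -> : ereal_inf [set t%:E | t in [set t : R | cone_le C x (t *: y)]] =
    (gauge C x y)%:E.
  apply/eqP; rewrite eq_le; apply/andP; split.
    by apply: ereal_inf_lbound; exists (gauge C x y) => //; exact: gauge_mem.
  by apply: le_ereal_inf_tmp => _ [t Ct <-]; rewrite lee_fin; exact: gauge_le.
have -> : ereal_sup [set t%:E | t in [set t : R | cone_le C (t *: y) x]] =
    ((gauge C y x)^-1)%:E.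
  apply/eqP; rewrite eq_le; apply/andP; split.
    apply: ge_ereal_sup => _ [t Ct <-]; rewrite lee_fin.
    have [t0|t0] := leP t 0; first by rewrite (le_trans t0)// invr_ge0 ltW.
    rewrite -(invrK t) lef_pV2 ?posrE ?invr_gt0//; apply: gauge_le => //.
    have -> : t^-1 *: x - y = t^-1 *: (x - t *: y).
      by rewrite scalerBr scalerA mulVf ?gt_eqF// scale1r.
    by apply: coneC => //; rewrite invr_ge0 ltW.
  apply: ereal_sup_ubound; exists (gauge C y x)^-1 => //.
  rewrite /cone_le/=.
  have -> : x - (gauge C y x)^-1 *: y = (gauge C y x)^-1 *: (gauge C y x *: x - y).
    by rewrite scalerBr scalerA mulVf ?gt_eqF// scale1r.
  by apply: coneC; [rewrite invr_ge0 ltW|exact: gauge_mem].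
rewrite inver gt_eqF ?invr_gt0// invrK -EFinM lne_EFin ?mulr_gt0//.
by rewrite lnM.
Qed.
End ProperCone.

(** * The infinitesimal rate *)

Section Rate.
Context (R : realType) (X : normedModType R) (C : set X).
Context (convexC : convex_set (C : set (convex_lmodType X))) (coneC : cone C).
Context (phi : X -> X).
Context (phi_diff : forall x, C° x -> differentiable phi x).
Context (phi_hom : forall (l : R) (x : X), 0 < l -> C° x ->
     phi (l *: x) = l *: phi x).

(** For [z] in [[0, x]] both terms of [pi z + nu (x - z) = 0] are nonnegative, so
    the constraint says [pi z = 0] and [nu z = 1]. *)
Lemma infinitesimal_rate_leP x a : C° x ->
  (infinitesimal_rate C phi x <= a%:E)%E <->
  forall z (nu pi : {scalar X}), order_segment C x z ->
    normalized_dual C x nu -> normalized_dual C x pi -> nu z = 1 -> pi z = 0 ->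
    nu ('d phi x z) - nu (phi x) - pi ('d phi x z) <= a.
Proof.
move=> Cx.
have euler : 'd phi x x = phi x.
  by apply: diff_homogeneous => [l l0|]; [exact: phi_hom|exact: phi_diff].
rewrite /infinitesimal_rate leeNl -EFinN; split.
- move=> H z nu pi xz nuP piP nuz piz.
  have : (- a%:E <= (pi ('d phi x z) + nu ('d phi x (x - z)))%:E)%E.
    apply: (le_trans H); apply: ge_ereal_inf.
    exists (ereal_inf [set (np.2 ('d phi x z) + np.1 ('d phi x (x - z)))%:E |
      np in [set np : {scalar X} * {scalar X} |
        [/\ normalized_dual C x np.1, normalized_dual C x np.2 &
            np.2 z + np.1 (x - z) = 0]]]); first by exists z.
    apply: ereal_inf_lbound; exists (nu, pi) => //=; split => //.
    by rewrite linearB nuP.2 nuz piz subrr addr0.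
  by rewrite lee_fin !linearB euler; lra.
- move=> H; apply: le_ereal_inf_tmp => _ [z xz <-].
  apply: le_ereal_inf_tmp => _ [[nu pi] /= [nuP piP npz] <-].
  rewrite lee_fin.
  have piz0 : 0 <= pi z by apply: piP.1; case: xz; rewrite /cone_le subr0.
  have nuz0 : 0 <= nu (x - z) by apply: nuP.1; case: xz.
  have piz : pi z = 0 by lra.
  have nuz : nu z = 1 by move: npz; rewrite linearB nuP.2; lra.
  have := H z nu pi xz nuP piP nuz piz.
  by rewrite !linearB euler; lra.
Qed.

Lemma dual_normalize (mu : {scalar X}) y : dual_cone C mu -> 0 < mu y ->
  exists l : {scalar X}, normalized_dual C y l /\ forall v, l v = mu v / mu y.
Proof.
move=> muC muy.
have [u v|b u|l lE] := @exists_scalar R X (fun v => mu v / mu y).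
- by rewrite linearD mulrDl.
- by rewrite scalarZ mulrA.
exists l; split => //; split; last by rewrite lE divff// gt_eqF.
by move=> c Cc; rewrite lE divr_ge0 ?(ltW muy)//; exact: muC.
Qed.

(** The form of the rate used along a segment: functionals and direction are not
    normalized.  It follows by taking [z = (v - lo y) / (hi - lo)]. *)
Lemma infinitesimal_rate_bound a y v (mu nu : {scalar X}) hi lo : C° y ->
  (infinitesimal_rate C phi y <= a%:E)%E ->
  dual_cone C mu -> dual_cone C nu -> 0 < mu y -> 0 < nu y -> lo < hi ->
  C (hi *: y - v) -> C (v - lo *: y) ->
  mu v = hi * mu y -> nu v = lo * nu y ->
  (mu ('d phi y v) / mu y - hi * (mu (phi y) / mu y)) -
  (nu ('d phi y v) / nu y - lo * (nu (phi y) / nu y)) <= a * (hi - lo).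
Proof.
move=> Cy /(infinitesimal_rate_leP _ Cy) ca muC nuC muy nuy lohi Chi Clo muv nuv.
have [mu' [mu'P mu'E]] := dual_normalize muC muy.
have [nu' [nu'P nu'E]] := dual_normalize nuC nuy.
have hl0 : 0 < hi - lo by rewrite subr_gt0.
pose z := (hi - lo)^-1 *: (v - lo *: y).
have euler : 'd phi y y = phi y.
  by apply: diff_homogeneous => [l l0|]; [exact: phi_hom|exact: phi_diff].
have Cz : C z by apply: coneC => //; rewrite invr_ge0 ltW.
have Cyz : C (y - z).
  have -> : y - z = (hi - lo)^-1 *: (hi *: y - v).
    rewrite /z -{1}(scale1r y) -(mulVf (lt0r_neq0 hl0)) -scalerA -scalerBr.
    by rewrite scalerBl opprB addrA subrK.
  by apply: coneC => //; rewrite invr_ge0 ltW.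
have := ca z mu' nu'; rewrite /order_segment/= /cone_le subr0 => /(_ (conj Cz Cyz) mu'P nu'P).
have zE (l : {scalar X}) : l z = (hi - lo)^-1 * (l v - lo * l y).
  by rewrite scalarZ linearB scalarZ.
have DzE (l : {scalar X}) : l ('d phi y z) =
    (hi - lo)^-1 * (l ('d phi y v) - lo * l (phi y)).
  have -> : 'd phi y z = (hi - lo)^-1 *: ('d phi y v - lo *: phi y).
    by rewrite /z linearZ linearB linearZ euler.
  by rewrite scalarZ linearB scalarZ.
rewrite !mu'E !nu'E !zE !DzE muv nuv.
have hl : hi - lo != 0 by rewrite gt_eqF.
have muy0 : mu y != 0 by rewrite gt_eqF.
have nuy0 : nu y != 0 by rewrite gt_eqF.
have -> : (hi - lo)^-1 * (hi * mu y - lo * mu y) / mu y = 1.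
  by field; rewrite muy0.
have -> : (hi - lo)^-1 * (lo * nu y - lo * nu y) / nu y = 0.
  by rewrite subrr mulr0 mul0r.
move=> /(_ erefl erefl).
rewrite -(ler_pM2r hl0); apply: le_trans; rewrite le_eqVlt; apply/orP; left.
apply/eqP; set A := mu ('d phi y v); set B := nu ('d phi y v).
set c := mu (phi y); set d := nu (phi y).
by field; rewrite hl muy0 nuy0.
Qed.

End Rate.

(** * Contraction along two solutions *)

Section Contraction.
Context (R : realType) (X : normedModType R) (n : nat) (dimX : Vector.axiom n X).
Context (C : set X) (closedC : closed C).
Context (convexC : convex_set (C : set (convex_lmodType X))) (coneC : cone C).
Context (pointedC : pointed_cone C) (properC : ~ C° 0).
Context (phi : X -> X).
Context (phi_diff : forall x, C° x -> differentiable phi x).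
Context (phi_hom : forall (l : R) (x : X), 0 < l -> C° x ->
     phi (l *: x) = l *: phi x).
Context (U : set X) (U_sub : U `<=` C°).
Context (convexU : convex_set (U : set (convex_lmodType X))).

(** The infinitesimal bound integrated along the segment from [x2] to [x1].
    Segments are geodesics of the Hilbert metric: the functionals that attain the
    two gauges at the end points remain extremal at every intermediate point. *)
Lemma hilbert_speed_le a x1 x2 (mu nu : {scalar X}) :
  (forall x, U x -> (infinitesimal_rate C phi x <= a%:E)%E) ->
  U x1 -> U x2 ->
  normalized_dual C x2 mu -> mu x1 = gauge C x1 x2 ->
  normalized_dual C x1 nu -> nu x2 = gauge C x2 x1 ->
  mu (phi x1) / mu x1 - mu (phi x2) / mu x2 +
  (nu (phi x2) / nu x2 - nu (phi x1) / nu x1) <= a * hilbert_metric C x1 x2.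
Proof.
move=> ca U1 U2 [mu0 mux2] mux1 [nu0 nux1] nux2.
have C1 := U_sub U1; have C2 := U_sub U2.
have M0 : 0 < gauge C x1 x2 by exact: gauge_gt0.
have N0 : 0 < gauge C x2 x1 by exact: gauge_gt0.
have CM : C (gauge C x1 x2 *: x2 - x1) by exact: gauge_mem.
have CN : C (gauge C x2 x1 *: x1 - x2) by exact: gauge_mem.
move: mux1 nux2 M0 N0 CM CN; rewrite /hilbert_metric.
set M := gauge C x1 x2; set N := gauge C x2 x1 => mux1 nux2 M0 N0 CM CN.
have MN1 : 1 <= M * N.
  by have := nu0 _ CM; rewrite linearB scalarZ nux1 nux2 subr_ge0.
rewrite -lnM ?posrE//.
(* Distance zero means that [x1] and [x2] are proportional, hence so are their
   velocities; otherwise the extremal ratios along the segment differ. *)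
move: MN1; rewrite le_eqVlt => /predU1P[MN1|MN1].
  have x1E : x1 = M *: x2.
    apply/esym/eqP; rewrite -subr_eq0; apply/eqP.
    apply: (cone_opp_eq0 pointedC) => //; rewrite opprB.
    have := coneC (ltW M0) CN.
    by rewrite scalerBr scalerA -MN1 scale1r.
  have phi1 : phi x1 = M *: phi x2 by rewrite x1E phi_hom.
  rewrite phi1 !scalarZ mux1 mux2 nux1 nux2 -MN1 ln1 mulr0.
  have NE : N = M^-1 by rewrite -(mulKf (lt0r_neq0 M0) N) -MN1 mulr1.
  rewrite NE le_eqVlt; apply/orP; left; apply/eqP.
  by field; rewrite gt_eqF.
pose v := x1 - x2; pose y s := x2 + s *: v.
have Uy s : 0 <= s <= 1 -> U (y s) by move=> s01; exact: convex_set_segment.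
pose D s := 'd phi (y s) v.
pose H s := mu (phi (y s)) / mu (y s) - nu (phi (y s)) / nu (y s)
   - a * (ln (mu (y s)) - ln (nu (y s))).
pose dH s := (mu (D s) / mu (y s) - mu (phi (y s)) / mu (y s) * (mu v / mu (y s)))
  - (nu (D s) / nu (y s) - nu (phi (y s)) / nu (y s) * (nu v / nu (y s)))
  - a * (mu v / mu (y s) - nu v / nu (y s)).
have muy s : mu (y s) = 1 + s * (M - 1).
  by rewrite linearD scalarZ linearB mux1 mux2.
have nuy s : nu (y s) = N + s * (1 - N).
  by rewrite linearD scalarZ linearB nux1 nux2.
have muy0 s : 0 <= s <= 1 -> 0 < mu (y s).
  by move=> /Uy/U_sub; exact: normalized_dual_gt0 (conj mu0 mux2).
have nuy0 s : 0 <= s <= 1 -> 0 < nu (y s).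
  by move=> /Uy/U_sub; exact: normalized_dual_gt0 (conj nu0 nux1).
have [Kmu Kmu0 muK] := finite_dim_bounded mu dimX.
have [Knu Knu0 nuK] := finite_dim_bounded nu dimX.
have Hd (s : R) : 0 <= s <= 1 -> is_derive s 1 H (dH s).
  move=> s01; have dy := is_derive1_line x2 v s.
  have dphi := is_derive1_diff_comp dy (phi_diff (U_sub (Uy s s01))).
  have d1 := is_derive1_div (is_derive1_lin_comp muK dphi)
    (is_derive1_lin_comp muK dy) (lt0r_neq0 (muy0 s s01)).
  have d2 := is_derive1_div (is_derive1_lin_comp nuK dphi)
    (is_derive1_lin_comp nuK dy) (lt0r_neq0 (nuy0 s s01)).
  have d3 := is_derive1_ln (is_derive1_lin_comp muK dy) (muy0 s s01).
  have d4 := is_derive1_ln (is_derive1_lin_comp nuK dy) (nuy0 s s01).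
  exact: (is_deriveB (is_deriveB d1 d2) (is_deriveZ a (is_deriveB d3 d4))).
have dH0 (s : R) : 0 <= s <= 1 -> dH s <= 0.
  move=> s01; have mp := muy0 s s01; have np := nuy0 s s01.
  have hi0 : C ((mu v / mu (y s)) *: y s - v).
    have -> : (mu v / mu (y s)) *: y s - v = (mu (y s))^-1 *: (M *: x2 - x1).
      rewrite -{2}(scale1r v) -(mulVf (lt0r_neq0 mp)) mulrC -!scalerA -scalerBr.
      congr (_ *: _); rewrite muy linearB mux1 mux2 /y scalerDr scalerA.
      rewrite scalerDl scale1r [_ * s]mulrC opprD addrACA subrr addr0.
      by rewrite scalerBl scale1r /v opprB addrA subrK.
    by apply: coneC => //; rewrite invr_ge0 ltW.
  have lo0 : C (v - (nu v / nu (y s)) *: y s).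
    have -> : v - (nu v / nu (y s)) *: y s = (nu (y s))^-1 *: (N *: x1 - x2).
      rewrite -{1}(scale1r v) -(mulVf (lt0r_neq0 np)) [nu v / _]mulrC -!scalerA -scalerBr.
      congr (_ *: _); rewrite nuy [nu v]linearB nux1 nux2 /y [_ *: (x2 + _)]scalerDr scalerA.
      rewrite [(N + _) *: v]scalerDl [_ * s]mulrC opprD addrACA subrr addr0.
      by rewrite scalerBl scale1r /v scalerBr opprB addrA subrK.
    by apply: coneC => //; rewrite invr_ge0 ltW.
  have lohi : nu v / nu (y s) < mu v / mu (y s).
    rewrite ltr_pdivrMr// mulrAC ltr_pdivlMr// muy nuy !linearB mux1 mux2 nux1 nux2.
    nra.
  have := infinitesimal_rate_bound coneC phi_diff phi_hom (U_sub (Uy s s01)) (ca _ (Uy s s01))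
    mu0 nu0 mp np lohi hi0 lo0.
  rewrite !divfK ?gt_eqF// => /(_ erefl erefl).
  rewrite /dH -/(D s) [_ * (mu v / _)]mulrC [_ * (nu v / _)]mulrC; lra.
have := deriv_le0_decr Hd dH0.
have y0 : y 0 = x2 by rewrite /y scale0r addr0.
have y1 : y 1 = x1 by rewrite /y scale1r subrKC.
rewrite /H y0 y1 mux1 mux2 nux1 nux2 ln1 lnM ?posrE//; lra.
Qed.

(** Above the gauge, [c y - x] is interior to the cone, an open condition on both
    points. *)
Lemma gauge_usc x1 x2 c (t : R) : C° (x1 t) -> C° (x2 t) ->
  {for t, continuous x1} -> {for t, continuous x2} ->
  gauge C (x1 t) (x2 t) < c -> \forall s \near t, C (c *: x2 s - x1 s).
Proof.
move=> C1 C2 c1 c2 gc.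
have Ci : C° (c *: x2 t - x1 t).
  have -> : c *: x2 t - x1 t = (c - gauge C (x1 t) (x2 t)) *: x2 t +
     (gauge C (x1 t) (x2 t) *: x2 t - x1 t).
    by rewrite addrA -scalerDl subrK.
  apply: cone_interiorD => //; last exact: gauge_mem.
  by apply: cone_interiorZ => //; rewrite subr_gt0.
have : (c *: x2 s - x1 s) @[s --> t] --> c *: x2 t - x1 t.
  by apply: cvgB => //; apply: cvgZl_tmp.
exact.
Qed.

Lemma hilbert_metric_usc x1 x2 c (t : R) : C° (x1 t) -> C° (x2 t) ->
  {for t, continuous x1} -> {for t, continuous x2} ->
  hilbert_metric C (x1 t) (x2 t) < c ->
  \forall s \near t, C° (x1 s) -> C° (x2 s) -> hilbert_metric C (x1 s) (x2 s) <= c.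
Proof.
move=> C1 C2 c1 c2 fc; rewrite /hilbert_metric.
pose d := (c - hilbert_metric C (x1 t) (x2 t)) / 2.
have d0 : 0 < d by rewrite divr_gt0// subr_gt0.
have bound x y : C° x -> C° y -> gauge C x y < gauge C x y * expR d.
  by move=> Cx Cy; rewrite ltr_pMr ?gauge_gt0// expR_gt1.
have n1 := gauge_usc C1 C2 c1 c2 (bound _ _ C1 C2).
have n2 := gauge_usc C2 C1 c2 c1 (bound _ _ C2 C1).
near=> s => Cs1 Cs2.
have g1 : gauge C (x1 s) (x2 s) <= gauge C (x1 t) (x2 t) * expR d.
  by apply: gauge_le => //; near: s.
have g2 : gauge C (x2 s) (x1 s) <= gauge C (x2 t) (x1 t) * expR d.
  by apply: gauge_le => //; near: s.
have lng x y x' y' : C° x -> C° y -> C° x' -> C° y' ->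
    gauge C x y <= gauge C x' y' * expR d ->
    ln (gauge C x y) <= ln (gauge C x' y') + d.
  move=> Cx Cy Cx' Cy' gg.
  rewrite -[d in leRHS]expRK -lnM ?posrE ?expR_gt0 ?gauge_gt0//.
  by rewrite ler_ln ?posrE ?mulr_gt0 ?expR_gt0 ?gauge_gt0.
have := lng _ _ _ _ Cs1 Cs2 C1 C2 g1; have := lng _ _ _ _ Cs2 Cs1 C2 C1 g2.
rewrite /d /hilbert_metric; lra.
Unshelve. all: by end_near. Qed.

(** [exp (- a t)] times the distance satisfies the hypotheses of [dini_le] with
    arbitrarily small slope: functionals attaining the gauges at [t] give a differentiable minorant
    that touches the distance at [t], and its derivative there is controlled by
    [hilbert_speed_le]. *)
Lemma hilbert_metric_contraction a x1 x2 (T : R) :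
  (forall x, U x -> (infinitesimal_rate C phi x <= a%:E)%E) ->
  0 <= T ->
  (forall t, 0 <= t <= T -> U (x1 t) /\ is_derive t 1 x1 (phi (x1 t))) ->
  (forall t, 0 <= t <= T -> U (x2 t) /\ is_derive t 1 x2 (phi (x2 t))) ->
  hilbert_metric C (x1 T) (x2 T) <= expR (a * T) * hilbert_metric C (x1 0) (x2 0).
Proof.
move=> ca T0 sol1 sol2.
pose g t := expR (- a * t) * hilbert_metric C (x1 t) (x2 t).
suff gT : g T <= g 0.
  rewrite mulrC -ler_pdivrMr ?expR_gt0// -expRN mulrC -mulNr.
  by move: gT; rewrite /g mulr0 expR0 mul1r.
have expd := is_derive1_expR_scale (- a).
apply/ler_addgt0Pl => e e0; rewrite addrC.
(* The denominator [T + 1] rather than [T] covers [T = 0]. *)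
pose e' := e / (T + 1).
have T1 : 0 < T + 1 by rewrite ltr_wpDl.
have e'0 : 0 < e' by rewrite divr_gt0.
apply: (@le_trans _ _ (g 0 + e' * T)); last first.
  by rewrite lerD2l /e' mulrAC ler_pdivrMr// ler_pM2l// lerDl ler01.
apply: dini_le => // t.
- move=> /andP[t0 tT] c gc.
  have t01 : 0 <= t <= T by rewrite t0 ltW.
  have [U1 d1] := sol1 t t01; have [U2 d2] := sol2 t t01.
  have et := expR_gt0 (- a * t).
  have fc : hilbert_metric C (x1 t) (x2 t) < c / expR (- a * t).
    by rewrite ltr_pdivlMr// mulrC.
  pose c1 := (hilbert_metric C (x1 t) (x2 t) + c / expR (- a * t)) / 2.
  have fc1 : hilbert_metric C (x1 t) (x2 t) < c1 by rewrite /c1; lra.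
  have c1c : expR (- a * t) * c1 < c by rewrite mulrC -ltr_pdivlMr// /c1; lra.
  have n1 := hilbert_metric_usc (U_sub U1) (U_sub U2) (is_derive1_continuous d1)
    (is_derive1_continuous d2) fc1.
  have n2 : \forall s \near t, expR (- a * s) * c1 < c.
    have ce : (fun s => expR (- a * s) * c1) @ t --> expR (- a * t) * c1.
      by apply: cvgMr_tmp; exact: is_derive1_continuous (expd t).
    exact: (cvgr_lt _ ce).
  have [d /= d0 H] := filterI n1 n2.
  exists d => // s /andP[ts std] sT.
  have s01 : 0 <= s <= T by rewrite sT (le_trans t0 ts).
  have [|h1 h2] := H s; first by rewrite /ball_/= distrC ger0_norm ?subr_ge0//; lra.
  rewrite /g (le_lt_trans _ h2)// ler_wpM2l ?expR_ge0// h1//; apply: U_sub.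
    exact: (sol1 s s01).1.
  exact: (sol2 s s01).1.
- move=> /andP[t0 tT].
  have t01 : 0 <= t <= T by rewrite tT ltW.
  have [U1 d1] := sol1 t t01; have [U2 d2] := sol2 t t01.
  have C1 := U_sub U1; have C2 := U_sub U2.
  have [mu [[mu0 mux2] mux1]] := gauge_attained closedC convexC coneC properC (x1 t) dimX C2.
  have [nu [[nu0 nux1] nux2]] := gauge_attained closedC convexC coneC properC (x2 t) dimX C1.
  have := hilbert_speed_le ca U1 U2 (conj mu0 mux2) mux1 (conj nu0 nux1) nux2.
  have mup x : C° x -> 0 < mu x by exact: normalized_dual_gt0 (conj mu0 mux2).
  have nup x : C° x -> 0 < nu x by exact: normalized_dual_gt0 (conj nu0 nux1).
  have [Kmu Kmu0 muK] := finite_dim_bounded mu dimX.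
  have [Knu Knu0 nuK] := finite_dim_bounded nu dimX.
  have k1 := is_derive1_ln (is_derive1_lin_comp muK d1) (mup _ C1).
  have k2 := is_derive1_ln (is_derive1_lin_comp muK d2) (mup _ C2).
  have k3 := is_derive1_ln (is_derive1_lin_comp nuK d2) (nup _ C2).
  have k4 := is_derive1_ln (is_derive1_lin_comp nuK d1) (nup _ C1).
  pose k s := ln (mu (x1 s)) - ln (mu (x2 s)) + (ln (nu (x2 s)) - ln (nu (x1 s))).
  have kd := is_deriveD (is_deriveB k1 k2) (is_deriveB k3 k4).
  set k' := (X in X <= _ -> _) => k'le.
  have {}kd : is_derive t 1 k k' by exact: kd.
  have kt : k t = hilbert_metric C (x1 t) (x2 t).
    by rewrite /k mux1 mux2 nux1 nux2 ln1 !subr0.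
  have k_le s : C° (x1 s) -> C° (x2 s) -> k s <= hilbert_metric C (x1 s) (x2 s).
    move=> Cs1 Cs2.
    by rewrite lerD//; apply: ln_dual_le_gauge => //; rewrite ?mup ?nup.
  have := is_deriveM (expd t) kd.
  move=> /is_derive1_littleP /(_ e' e'0)[d /= d0 H].
  pose r := Num.min (d / 2) t.
  have r0 : 0 < r by rewrite lt_min t0 divr_gt0.
  have rt : r <= t by rewrite ge_min lexx orbT.
  have rd : r < d.
    have : r <= d / 2 by rewrite ge_min lexx.
    lra.
  exists (t - r); first by lra.
  have s01 : 0 <= t - r <= T by lra.
  have := H (- r); rewrite /ball_/= sub0r opprK normrN gtr0_norm// => /(_ rd).
  rewrite ler_norml => /andP[+ _].
  have ks := k_le (t - r) (U_sub (sol1 _ s01).1) (U_sub (sol2 _ s01).1).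
  have es := expR_gt0 (- a * (t - r)).
  have et := expR_gt0 (- a * t).
  rewrite /g -kt.
  set E1 := expR (- a * (t - r)) in es *; set E2 := expR (- a * t) in et *.
  move=> Hr.
  have gs : E1 * k (t - r) <= E1 * hilbert_metric C (x1 (t - r)) (x2 (t - r)) by rewrite ler_pM2l.
  apply: le_trans gs.
  have scE (b c : R) : b *: c = b * c by [].
  have {}Hr : - (e' * r) <= E1 * k (t - r) - E2 * k t -
      - r * (E2 * k' + k t * (- a * E2)) by rewrite -!scE; exact: Hr.
  rewrite -kt in k'le.
  have : r * (E2 * (k' - a * k t)) <= 0.
    by rewrite pmulr_rle0// pmulr_rle0// subr_le0.
  move: Hr; lra.
Qed.

End Contraction.

(** * The flow and its exit time *)

Section Flow.
Context (R : realType) (X : normedModType R) (n : nat) (dimX : Vector.axiom n X).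
Context (D : set X) (openD : open D) (phi : X -> X).
Context (phi_C1 : continuously_differentiable_on D phi).

Lemma flow_solution x :
  D x -> is_solution phi D x (flow_domain phi D x) (fun t => flow phi D t x).
Proof. by move=> Dx; case: (maximal_solution_exists dimX openD phi_C1 Dx). Qed.

Lemma flow_before_exit U x T : D x -> 0 <= T -> (T%:E < exit_time phi D U x)%E ->
  forall t, 0 <= t <= T -> U (flow phi D t x) /\
    is_derive t 1 (fun t => flow phi D t x) (phi (flow phi D t x)).
Proof.
move=> Dx T0 /ereal_sup_gt[_ [t0 [Jt0 _ Ut0] <-]]; rewrite lte_fin => Tt0 t /andP[t_0 tT].
have [_ itv J0 _ sol] := flow_solution Dx.
have tt0 : t < t0 by exact: le_lt_trans Tt0.
split; first by apply: Ut0; rewrite t_0.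
by apply: (sol t _).2; apply: itv J0 Jt0 _ _; rewrite t_0 ltW.
Qed.

Lemma exit_time_gt0 U x : U `<=` D -> open U -> U x ->
  exists2 t : R, 0 < t & (t%:E <= exit_time phi D U x)%E.
Proof.
move=> UD oU Ux; have [oJ _ J0 x_0 sol] := flow_solution (UD _ Ux).
have cx := is_derive1_continuous (sol 0 J0).2.
have nU : nbhs (flow phi D 0 x) U by rewrite x_0; exact: open_nbhs_nbhs.
have [e /= e0 H] := filterI (open_nbhs_nbhs (conj oJ J0)) (cx _ nU).
have he t : 0 <= t < e -> flow_domain phi D x t /\ U (flow phi D t x).
  move=> /andP[t0 te]; apply: H.
  by rewrite /ball_/= sub0r normrN ger0_norm.
exists (e / 2); first by rewrite divr_gt0.
apply: ereal_sup_ubound; exists (e / 2) => //; split.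
- by apply: (he _ _).1; lra.
- by rewrite divr_ge0// ltW.
- by move=> t /andP[t0 te]; apply: (he _ _).2; lra.
Qed.

End Flow.

(** * The optimal contraction rate *)

Definition contracts_at_rate (R : realType) (X : normedModType R) (C : set X)
    (phi : X -> X) (U : set X) (a : R) :=
  forall x1 x2, U x1 -> U x2 -> forall t : R, 0 <= t ->
  (t%:E < Order.min (exit_time phi C° U x1) (exit_time phi C° U x2))%E ->
  (hilbert_dist C (flow phi C° t x1) (flow phi C° t x2)
     <= (expR (a * t))%:E * hilbert_dist C x1 x2)%E.

Section MainProof.
Context (R : realType) (X : normedModType R) (n : nat) (dimX : Vector.axiom n X).
Context (C : set X) (closedC : closed C).
Context (convexC : convex_set (C : set (convex_lmodType X))) (coneC : cone C).
Context (pointedC : pointed_cone C).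
Context (phi : X -> X) (phi_C1 : continuously_differentiable_on C° phi).
Context (phi_hom : forall (l : R) (x : X), 0 < l -> C° x ->
     phi (l *: x) = l *: phi x).
Context (U : set X) (U_sub : U `<=` C°).
Context (convexU : convex_set (U : set (convex_lmodType X))) (openU : open U).

Lemma hilbert_dist_trivial : C 0 -> (forall x : X, x = 0) ->
  forall x y, hilbert_dist C x y = -oo%E.
Proof.
move=> C0 X0 x y; rewrite /hilbert_dist.
have -> : [set t : R | cone_le C x (t *: y)] = setT.
  by apply/seteqP; split => // t _ /=; rewrite /cone_le (X0 (_ - _)).
have -> : [set t : R | cone_le C (t *: y) x] = setT.
  by apply/seteqP; split => // t _ /=; rewrite /cone_le (X0 (_ - _)).
rewrite ereal_sup_real ereal_inf_real invey mule0.
by rewrite le0_lneNy.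
Qed.

Lemma rate_upper_bound a :
  (forall x, U x -> (infinitesimal_rate C phi x <= a%:E)%E) ->
  contracts_at_rate C phi U a.
Proof.
move=> ca x1 x2 U1 U2 t t0; rewrite lt_min => /andP[t1 t2].
have oC : open C° by exact: open_interior.
have [C0|properC] := pselect (C° 0).
  have X0 := trivial_cone coneC pointedC C0.
  by rewrite hilbert_dist_trivial ?leNye//; exact: interior_subset.
have sol1 := flow_before_exit dimX oC phi_C1 (U_sub U1) t0 t1.
have sol2 := flow_before_exit dimX oC phi_C1 (U_sub U2) t0 t2.
have tt : 0 <= t <= t by rewrite t0 lexx.
rewrite !hilbert_distE//; try exact: U_sub.
  rewrite -EFinM lee_fin.
  have := hilbert_metric_contraction dimX closedC convexC coneC pointedC properC phi_C1.1 phi_hom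
    U_sub convexU ca t0 sol1 sol2.
  have [_ _ _ -> _] := flow_solution dimX oC phi_C1 (U_sub U1).
  by have [_ _ _ -> _] := flow_solution dimX oC phi_C1 (U_sub U2).
  exact: U_sub (sol1 t tt).1.
  exact: U_sub (sol2 t tt).1.
Qed.

Lemma hilbert_dist_tangent_le x z e : ~ C° 0 -> C° x -> order_segment C x z -> 0 <= e ->
  hilbert_metric C (x + e *: z) x <= ln (1 + e).
Proof.
move=> properC Cx [Cz Czx] e0.
have {}Cz : C z by move: Cz; rewrite /cone_le subr0.
have Cxz : C° (x + e *: z).
  by apply: cone_interiorD => //; exact: coneC.
have g1 : gauge C (x + e *: z) x <= 1 + e.
  apply: gauge_le => //.
  by rewrite scalerDl scale1r opprD addrACA subrr add0r -scalerBr; exact: coneC.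
have g2 : gauge C x (x + e *: z) <= 1.
  by apply: gauge_le => //; rewrite scale1r addrAC subrr add0r; exact: coneC.
have p1 : 0 < gauge C (x + e *: z) x by exact: gauge_gt0.
have p2 : 0 < gauge C x (x + e *: z) by exact: gauge_gt0.
have -> : ln (1 + e) = ln (1 + e) + ln 1 by rewrite ln1 addr0.
by rewrite /hilbert_metric lerD// ler_ln ?posrE//; lra.
Qed.

(** [h] compares the minorant of the distance given by [nu] and [pi] with the
    contraction bound; it vanishes at time 0, so its derivative there, which is
    [Psi e], is nonpositive.  In turn [Psi] vanishes at 0, and its derivative
    there is the inequality sought. *)
Lemma rate_lower_bound a x : contracts_at_rate C phi U a -> U x ->
  (infinitesimal_rate C phi x <= a%:E)%E.
Proof.
move=> ha Ux; have Cx := U_sub Ux.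
apply/(infinitesimal_rate_leP phi_C1.1 phi_hom _ Cx) => z nu pi xz nuP piP nuz piz.
have properC : ~ C° 0.
  move=> C0; have [_] := nuP; rewrite (trivial_cone coneC pointedC C0 x) linear0.
  by move/esym/eqP; rewrite oner_eq0.
have oC : open C° by exact: open_interior.
have [Knu Knu0 nuK] := finite_dim_bounded nu dimX.
have [Kpi Kpi0 piK] := finite_dim_bounded pi dimX.
have nup y : C° y -> 0 < nu y by exact: normalized_dual_gt0 nuP.
have pip y : C° y -> 0 < pi y by exact: normalized_dual_gt0 piP.
pose y (e : R) := x + e *: z.
have y0 : y 0 = x by rewrite /y scale0r addr0.
have [e1 e10 Uy] : exists2 e1 : R, 0 < e1 & forall e, 0 <= e < e1 -> U (y e).
  have cy : {for 0, continuous y} := is_derive1_continuous (is_derive1_line x z 0).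
  have nU : nbhs (y 0) U by rewrite y0; exact: open_nbhs_nbhs.
  have [e /= e0 H] := cy _ nU; exists e => // e' /andP[e'0 e'e]; apply: H.
  by rewrite /ball_/= sub0r normrN ger0_norm.
have nuy e : nu (y e) = 1 + e by rewrite linearD scalarZ nuz nuP.2 mulr1.
have piy e : pi (y e) = 1 by rewrite linearD scalarZ piz piP.2 mulr0 addr0.
pose Psi e := nu (phi (y e)) / nu (y e) - nu (phi x) / nu x
  - (pi (phi (y e)) / pi (y e) - pi (phi x) / pi x) - a * ln (1 + e).
have Psi_le e : 0 <= e < e1 -> Psi e <= 0.
  move=> e01; have Uye := Uy e e01; have /andP[e0 _] := e01.
  have [t1 t10 ex1] := exit_time_gt0 dimX oC phi_C1 U_sub openU Uye.
  have [t2 t20 ex2] := exit_time_gt0 dimX oC phi_C1 U_sub openU Ux.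
  pose x1 t := flow phi C° t (y e); pose x2 t := flow phi C° t x.
  have [_ _ _ x10 _] := flow_solution dimX oC phi_C1 (U_sub Uye).
  have [_ _ _ x20 _] := flow_solution dimX oC phi_C1 Cx.
  pose psi t := ln (nu (x1 t)) - ln (nu (x2 t)) - (ln (pi (x1 t)) - ln (pi (x2 t))).
  pose h t := psi t - expR (a * t) * ln (1 + e).
  have before t : 0 <= t < Num.min t1 t2 ->
      (t%:E < exit_time phi C° U (y e))%E /\ (t%:E < exit_time phi C° U x)%E.
    rewrite lt_min => /andP[_ /andP[tt1 tt2]].
    by split; [apply: lt_le_trans ex1|apply: lt_le_trans ex2]; rewrite lte_fin.
  have tau0 : 0 < Num.min t1 t2 by rewrite lt_min t10 t20.
  have h_le t : 0 <= t < Num.min t1 t2 -> h t <= 0.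
    move=> t01; have [ty tx] := before t t01; have /andP[t0 _] := t01.
    have tt : 0 <= t <= t by rewrite t0 lexx.
    have C1 : C° (x1 t).
      exact: U_sub (flow_before_exit dimX oC phi_C1 (U_sub Uye) t0 ty tt).1.
    have C2 : C° (x2 t).
      exact: U_sub (flow_before_exit dimX oC phi_C1 Cx t0 tx tt).1.
    have := ha _ _ Uye Ux t t0; rewrite lt_min ty tx => /(_ isT).
    rewrite !hilbert_distE//; last exact: U_sub.
    rewrite -EFinM lee_fin -/(x1 t) -/(x2 t) => H.
    have H2 := hilbert_dist_tangent_le properC Cx xz e0.
    have H3 : psi t <= hilbert_metric C (x1 t) (x2 t).
      rewrite /psi opprB lerD//; apply: ln_dual_le_gauge; rewrite ?nup ?pip//.
        exact: nuP.1.
      exact: piP.1.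
    rewrite /h subr_le0 (le_trans H3)// (le_trans H)//.
    by rewrite ler_pM2l ?expR_gt0.
  have h0 : h 0 = 0.
    by rewrite /h /psi /x1 /x2 x10 x20 mulr0 expR0 mul1r nuy piy nuP.2 piP.2 ln1 !subr0 subrr.
  have t0t : 0 <= (0 : R) by [].
  have tt0 : 0 <= (0 : R) <= 0 by rewrite lexx.
  have [] := before 0; first by rewrite lexx.
  move=> b1 b2.
  have d1 := (flow_before_exit dimX oC phi_C1 (U_sub Uye) t0t b1 tt0).2.
  have d2 := (flow_before_exit dimX oC phi_C1 Cx t0t b2 tt0).2.
  have C1 : C° (x1 0) by rewrite /x1 x10; exact: U_sub.
  have C2 : C° (x2 0) by rewrite /x2 x20.
  have k1 := is_derive1_ln (is_derive1_lin_comp nuK d1) (nup _ C1).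
  have k2 := is_derive1_ln (is_derive1_lin_comp nuK d2) (nup _ C2).
  have k3 := is_derive1_ln (is_derive1_lin_comp piK d1) (pip _ C1).
  have k4 := is_derive1_ln (is_derive1_lin_comp piK d2) (pip _ C2).
  have expd : is_derive (0 : R) 1 (fun s => expR (a * s) * ln (1 + e)) (a * ln (1 + e)).
    have -> : (fun s => expR (a * s) * ln (1 + e)) = ln (1 + e) \*: (fun s => expR (a * s)).
      by apply/funext => s; rewrite mulrC.
    apply: (is_derive_eq (is_deriveZ (ln (1 + e)) (is_derive1_expR_scale a 0))).
    by rewrite mulr0 expR0 mulr1 [LHS]mulrC.
  have := deriv_le0_right tau0 h0 h_le
    (is_deriveB (is_deriveB (is_deriveB k1 k2) (is_deriveB k3 k4)) expd).
  by rewrite /= x10 x20.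
have Psi0 : Psi 0 = 0 by rewrite /Psi y0 addr0 ln1 mulr0 !subrr.
have dl : is_derive (0 : R) 1 (fun e => a * ln (1 + e)) a.
  have d1 : is_derive (0 : R) 1 (fun e : R => 1 + e) 1.
    apply: (is_derive_eq (is_deriveD (is_derive_cst (1 : R) (0 : R) 1) (is_derive_id (0 : R) 1))).
    by rewrite add0r.
  have d1' : 0 < (1 + 0 : R) by rewrite addr0.
  apply: (is_derive_eq (is_deriveZ a (is_derive1_ln d1 d1'))).
  by rewrite addr0 divr1 [LHS]mulr1.
have dy := is_derive1_line x z (0 : R).
have dphi : is_derive (0 : R) 1 (phi \o y) ('d phi x z).
  have := @is_derive1_diff_comp _ _ _ phi _ _ _ dy.
  by rewrite scale0r addr0; apply; exact: phi_C1.1.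
have c1 := is_derive_cst (nu (phi x) / nu x) (0 : R) (1 : R).
have c2 := is_derive_cst (pi (phi x) / pi x) (0 : R) (1 : R).
have q1 := is_derive1_div (is_derive1_lin_comp nuK dphi) (is_derive1_lin_comp nuK dy).
have q2 := is_derive1_div (is_derive1_lin_comp piK dphi) (is_derive1_lin_comp piK dy).
have n1 : (nu \o y) 0 != 0 by rewrite /= y0 nuP.2 oner_eq0.
have n2 : (pi \o y) 0 != 0 by rewrite /= y0 piP.2 oner_eq0.
have := deriv_le0_right e10 Psi0 Psi_le
  (is_deriveB (is_deriveB (is_deriveB (q1 n1) c1) (is_deriveB (q2 n2) c2)) dl).
rewrite /= y0 !scale0r !addr0 nuP.2 piP.2 nuz piz; lra.
Qed.

End MainProof.

Theorem theorem7p1 (R : realType) (X : normedModType R)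
  (n : nat) (dimX : Vector.axiom n X)
  (C : set X) (closedC : closed C)
  (convexC : convex_set (C : set (convex_lmodType X))) (coneC : cone C)
  (pointedC : pointed_cone C) (solidC : C° !=set0)
  (phi : X -> X) (phi_C1 : continuously_differentiable_on C° phi)
  (phi_hom : forall (l : R) (x : X), 0 < l -> C° x ->
     phi (l *: x) = l *: phi x)
  (U : set X) (U_sub : U `<=` C°)
  (convexU : convex_set (U : set (convex_lmodType X))) (openU : open U)
  (U_hom : forall l : R, 0 < l -> [set l *: x | x in U] = U) :
  contraction_rate C phi U =
  ereal_sup [set infinitesimal_rate C phi x | x in U].
Proof.
apply/eqP; rewrite eq_le; apply/andP; split.
- have le_real (a : R) : (ereal_sup [set infinitesimal_rate C phi x | x in U] <= a%:E)%E ->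
      (contraction_rate C phi U <= a%:E)%E.
    move=> ca; apply: ereal_inf_lbound; exists a => //.
    apply: (rate_upper_bound dimX closedC convexC coneC pointedC phi_C1 phi_hom U_sub convexU).
    by move=> x Ux; apply: le_trans ca; apply: ereal_sup_ubound; exists x.
  move: le_real; case: (ereal_sup _) => [r|_|le_real]; first exact.
    by rewrite leey.
  case: (contraction_rate C phi U) le_real => [r le_real|/(_ 0 (leNye _))//|//].
  have := le_real (r - 1) (leNye _); rewrite lee_fin => r_le.
  by exfalso; lra.
- apply: le_ereal_inf_tmp => _ [a ha <-]; apply: ge_ereal_sup => _ [x Ux <-].
  exact: (rate_lower_bound dimX closedC convexC coneC pointedC phi_C1 phi_hom U_sub openU).
Qed.
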